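(* Let $\mathcal{M}\subset B(\mathcal{H})$ be a unital operator space and let $\pi:C^*(\mathcal{M})\rightarrow B(\mathcal{H}_\pi)$ be a $*$-representation that possesses the approximate unique extension property with respect to $\mathcal{M}$. Suppose that $\psi:C^*(\mathcal{M})\rightarrow B(\mathcal{H}_\pi)$ is a unital completely positive map satisfying $\psi|_{\mathcal{M}}=\pi|_{\mathcal{M}}$. Then the following statements hold. (i) There is a homomorphic conditional expectation $\Gamma_\psi:C^*(\mathrm{Im}\,\psi)\rightarrow\mathrm{Im}\,\pi$ satisfying $\Gamma_\psi\circ\psi=\pi$. (ii) The conditional expectation $\Gamma_\psi$ has the unique extension property with respect to $\mathrm{Im}\,\psi$. (iii) $\ker\Gamma_\psi$ is the smallest closed two-sided ideal of $C^*(\mathrm{Im}\,\psi)$ that contains $\mathrm{Im}(\psi-\pi)$. In particular, $\psi=\pi$ if and only if $\Gamma_\psi$ is isometric.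
   Context: A unital operator space is a linear subspace $\mathcal{M}\subset B(\mathcal{H})$, $\mathcal{H}$ a Hilbert space, containing the identity; $C^*(\mathcal{M})\subset B(\mathcal{H})$ is the $C^*$-algebra it generates. $*$-representations of unital $C^*$-algebras are on Hilbert spaces and are unital. A $*$-representation $\sigma:C^*(\mathcal{M})\to B(\mathcal{H}_\sigma)$ has the unique extension property with respect to $\mathcal{M}$ if, whenever $\psi:C^*(\mathcal{M})\to B(\mathcal{H}_\sigma)$ is unital completely positive with $\psi|_{\mathcal{M}}=\sigma|_{\mathcal{M}}$, then $\psi=\sigma$. It has the approximate unique extension property with respect to $\mathcal{M}$ if, for every such $\psi$, there is a net of unitaries $u_\beta\in B(\mathcal{H}_\sigma)$ with $u_\beta^*\psi(t)u_\beta\to\sigma(t)$ in the weak operator topology for every $t\in C^*(\mathcal{M})$. In (ii), $\mathrm{Im}\,\psi\subset B(\mathcal{H}_\pi)$ is the unital operator space, $C^*(\mathrm{Im}\,\psi)$ the $C^*$-algebra it generates, and $\Gamma_\psi$ is regarded as a $*$-representation of $C^*(\mathrm{Im}\,\psi)$ on $\mathcal{H}_\pi$. For $C^*$-algebras $\mathfrak{A}\subset\mathfrak{B}$, a conditional expectation $\mathfrak{B}\to\mathfrak{A}$ is a contractive linear projection of $\mathfrak{B}$ onto $\mathfrak{A}$; it is homomorphic if it is multiplicative. (Here $\mathrm{Im}\,\pi=C^*(\pi(\mathcal{M}))=C^*(\psi(\mathcal{M}))\subset C^*(\mathrm{Im}\,\psi)$.) *)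

(* Defs.v *)
From HB Require Import structures.
From mathcomp Require Import all_boot all_order all_algebra.
From mathcomp Require Import all_classical all_reals all_analysis.
From mathcomp Require Import sesquilinear complex.
Set Implicit Arguments.
Unset Strict Implicit.
Unset Printing Implicit Defensive.
Import Order.TTheory GRing.Theory Num.Theory.
Import numFieldNormedType.Exports.
Local Open Scope classical_set_scope.
Local Open Scope ring_scope.
Local Open Scope complex_scope.

HB.mixin Record CompleteNormedModule_isHilbert (R : realType) H
    & CompleteNormedModule R[i] H := {
  dot : {dot H for Num.conj} ;
  dotxx : forall x : H, dot x x = `|x| ^+ 2
}.

#[short(type="hilbertType")]
HB.structure Definition Hilbert (R : realType) :=
  {H of CompleteNormedModule_isHilbert R H & CompleteNormedModule R[i] H}.

Lemma real_complexD (R : rcfType) (x y : R) : (x + y)%:C = x%:C + y%:C.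
Proof. exact: rmorphD. Qed.

Lemma real_complexM (R : rcfType) (x y : R) : (x * y)%:C = x%:C * y%:C.
Proof. exact: rmorphM. Qed.

Section RealNorm.
Variables (R : realType) (V : normedModType R[i]).

Definition rnorm (x : V) : R := complex.Re `|x|.

Lemma rnormE x : (rnorm x)%:C = `|x|.
Proof. by rewrite RRe_real// normr_real. Qed.

Lemma rnorm_ge0 x : 0 <= rnorm x. Proof. by rewrite -ler0c rnormE. Qed.

End RealNorm.

Section BoundedOperators.
Variables (R : realType) (H : hilbertType R).

Definition bounded_linear : {pred H -> H} := fun f =>
  `[< linear f /\ exists M : R, forall x, `|f x| <= M%:C * `|x| >].

Record bop := Bop { bop_fun :> H -> H ; bop_subproof : bop_fun \in bounded_linear }.

HB.instance Definition _ := [isSub for bop_fun].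
HB.instance Definition _ := [Choice of bop by <:].

Lemma bopD (T : bop) x y : T (x + y) = T x + T y.
Proof.
have /asboolP[/(_ 1 x y)] : bop_fun T \in bounded_linear by exact: bop_subproof.
by rewrite !scale1r.
Qed.

Lemma bop0 (T : bop) : T 0 = 0.
Proof. by apply: (addrI (T 0)); rewrite -bopD !addr0. Qed.

Lemma bopZ (T : bop) k x : T (k *: x) = k *: T x.
Proof.
have /asboolP[/(_ k x 0)] : bop_fun T \in bounded_linear by exact: bop_subproof.
by rewrite addr0 bop0 addr0.
Qed.

HB.instance Definition _ (T : bop) :=
  GRing.isSemilinear.Build R[i] H H *:%R T (bopZ T, bopD T).

Lemma bop_bounded (T : bop) :
  exists2 M : R, 0 <= M & forall x, `|T x| <= M%:C * `|x|.
Proof.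
have /asboolP[_ [M TM]] : bop_fun T \in bounded_linear by exact: bop_subproof.
exists `|M|; first exact: normr_ge0.
by move=> x; apply: (le_trans (TM x)); rewrite ler_wpM2r// lecR ler_norm.
Qed.

Lemma bounded_linear_submod : submod_closed bounded_linear.
Proof.
split.
  apply/asboolP; split => [k x y|]; first by rewrite /GRing.zero/= scaler0 addr0.
  by exists 0 => x; rewrite normr0 mul0r.
move=> k f g /asboolP[fl [M fM]] /asboolP[gl [N gN]]; apply/asboolP; split.
  move=> a x y; rewrite !fctE fl gl !scalerDr !scalerA mulrC -!addrA.
  by congr (_ + _); rewrite addrCA.
exists (rnorm (k : R[i]^o) * M + N) => x; rewrite fctE (le_trans (ler_normD _ _))//.
rewrite normrZ real_complexD real_complexM mulrDl lerD//.
by rewrite (rnormE (k : R[i]^o)) -mulrA ler_wpM2l.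
Qed.

HB.instance Definition _ :=
  GRing.isSubmodClosed.Build R[i] (H -> H) bounded_linear bounded_linear_submod.
HB.instance Definition _ := [SubChoice_isSubLmodule of bop by <:].

Lemma bounded_linear_id : idfun \in bounded_linear.
Proof. by apply/asboolP; split => //; exists 1 => x; rewrite mul1r. Qed.

Lemma bounded_linear_comp (S T : bop) : S \o T \in bounded_linear.
Proof.
apply/asboolP; split => [k x y|]; first by rewrite /= !linearP.
have [M M0 SM] := bop_bounded S; have [N _ TN] := bop_bounded T.
exists (M * N) => x /=; rewrite (le_trans (SM _))// real_complexM -mulrA.
by rewrite ler_wpM2l// ler0c.
Qed.

Definition bop_one := Bop bounded_linear_id.
Definition bop_mul S T := Bop (bounded_linear_comp S T).

Lemma bopP (S T : bop) : S =1 T -> S = T.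
Proof. by move=> ST; apply/val_inj/funext. Qed.

Lemma bop_mulA : associative bop_mul. Proof. by move=> *; exact: bopP. Qed.
Lemma bop_mul1l : left_id bop_one bop_mul. Proof. by move=> *; exact: bopP. Qed.
Lemma bop_mul1r : right_id bop_one bop_mul. Proof. by move=> *; exact: bopP. Qed.
Lemma bop_mulDl : left_distributive bop_mul +%R.
Proof. by move=> *; exact: bopP. Qed.
Lemma bop_mulDr : right_distributive bop_mul +%R.
Proof. by move=> S T U; apply: bopP => x; rewrite /= !fctE linearD. Qed.

HB.instance Definition _ := GRing.Zmodule_isPzRing.Build bop
  bop_mulA bop_mul1l bop_mul1r bop_mulDl bop_mulDr.

Lemma bopZE k (T : bop) x : (k *: T) x = k *: T x. Proof. by []. Qed.
Lemma bopDE (S T : bop) x : (S + T) x = S x + T x. Proof. by []. Qed.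

Definition opnorm (T : bop) : R :=
  sup [set rnorm (T x) | x in [set x | `|x| <= 1]].

Lemma has_sup_opnorm (T : bop) :
  has_sup [set rnorm (T x) | x in [set x | `|x| <= 1]].
Proof.
split; first by exists (rnorm (T 0)), 0 => //=; rewrite normr0 ler01.
have [M M0 TM] := bop_bounded T; exists M => _ [x /= x1 <-].
rewrite -lecR rnormE (le_trans (TM x))//.
by rewrite ler_piMr// ler0c.
Qed.

Lemma opnorm_ge0 (T : bop) : 0 <= opnorm T.
Proof.
apply: (le_trans (rnorm_ge0 (T 0))).
apply: sup_upper_bound; first exact: has_sup_opnorm.
by exists 0 => //=; rewrite normr0 ler01.
Qed.

Lemma opnorm_ub (T : bop) x : `|T x| <= (opnorm T)%:C * `|x|.
Proof.
have [->|x0] := eqVneq x 0; first by rewrite linear0 !normr0 mulr0.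
have nx : 0 < `|x| by rewrite normr_gt0.
rewrite -ler_pdivrMr// mulrC.
rewrite (_ : _ * _ = `|T (`|x|^-1 *: x)|); last first.
  by rewrite linearZ normrZ normfV normr_id.
rewrite -rnormE lecR; apply: sup_upper_bound; first exact: has_sup_opnorm.
by exists (`|x|^-1 *: x) => //=; rewrite normrZ normfV normr_id mulVf ?gt_eqF.
Qed.

Lemma opnorm_le (T : bop) M : 0 <= M -> (forall x, `|T x| <= M%:C * `|x|) ->
  opnorm T <= M.
Proof.
move=> M0 TM; apply: ge_sup; first by case: (has_sup_opnorm T).
move=> _ [x /= x1 <-]; rewrite -lecR rnormE.
by rewrite (le_trans (TM x))// ler_piMr// ler0c.
Qed.

Lemma opnormD S T : (opnorm (S + T))%:C <= (opnorm S)%:C + (opnorm T)%:C.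
Proof.
rewrite -real_complexD lecR; apply: opnorm_le => [|x].
  by rewrite addr_ge0 ?opnorm_ge0.
by rewrite real_complexD mulrDl (le_trans (ler_normD _ _))// lerD ?opnorm_ub.
Qed.

Lemma opnormZ_le k (T : bop) : opnorm (k *: T) <= rnorm (k : R[i]^o) * opnorm T.
Proof.
apply: opnorm_le => [|x].
  by rewrite mulr_ge0 ?opnorm_ge0// rnorm_ge0.
rewrite real_complexM (rnormE (k : R[i]^o)) bopZE normrZ -mulrA.
by rewrite ler_wpM2l ?opnorm_ub.
Qed.

Lemma opnormZ k (T : bop) : (opnorm (k *: T))%:C = `|k| * (opnorm T)%:C.
Proof.
rewrite -(rnormE (k : R[i]^o)) -real_complexM; congr _%:C.
apply/eqP; rewrite eq_le opnormZ_le/=.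
have [->|k0] := eqVneq k 0; first by rewrite /rnorm normr0 mul0r opnorm_ge0.
have := opnormZ_le k^-1 (k *: T); rewrite scalerA mulVf// scale1r.
move=> /(ler_wpM2l _) h; apply: le_trans (h (rnorm (k : R[i]^o)) _) _.
  exact: rnorm_ge0.
rewrite mulrA [X in X * _](_ : _ = 1) ?mul1r//.
apply: (@complexI R); rewrite real_complexM !(rnormE (_ : R[i]^o)).
by rewrite -normrM divff// normr1.
Qed.

Lemma opnorm_eq0 (T : bop) : (opnorm T)%:C = 0 -> T = 0.
Proof.
move=> T0; apply: bopP => x; apply/eqP; rewrite -normr_le0.
by rewrite (le_trans (opnorm_ub T x))// T0 mul0r.
Qed.

HB.instance Definition _ := Lmodule_isNormed.Build R[i] bop
  opnormD opnormZ opnorm_eq0.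

End BoundedOperators.

Notation "''B' ( H )" := (bop H) (at level 8, format "''B' ( H )") : type_scope.

Section OperatorAlgebras.
Variables (R : realType) (H : hilbertType R).
Implicit Types (A B J M : set 'B(H)) (T : 'B(H)).

(* By the Riesz representation theorem exactly one S satisfies the defining
   condition, so that the default value 0 is never used. *)
Definition adj T : 'B(H) :=
  xget 0 [set S : 'B(H) | forall x y, dot (T x) y = dot x (S y)].

Definition unitary T := adj T * T = 1 /\ T * adj T = 1.

Definition unital_operator_space M := submod_closed [in M] /\ M 1.

Definition cstar_subalgebra A :=
  [/\ submod_closed [in A],
      {in A &, forall a b, A (a * b)},
      {in A, forall a, A (adj a)}
    & closed A].

Definition cstar M : set 'B(H) := smallest cstar_subalgebra M.

Definition closed_ideal B J :=
  [/\ J `<=` B,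
      submod_closed [in J],
      {in B & J, forall b x, J (b * x) /\ J (x * b)}
    & closed J].

(* A matrix over B(H) acts as an operator on the direct sum of n copies of H;
   the condition is the positivity of that operator. *)
Definition positive_mx n (a : 'M['B(H)]_n) :=
  forall x : 'I_n -> H, 0 <= \sum_i \sum_j dot (a i j (x j)) (x i).

(* Convergence of S to T in the weak operator topology along the filter F. *)
Definition wot_cvg I (F : set_system I) (S : I -> 'B(H)) T :=
  forall x y, dot (S i x) y @[i --> F] --> (dot (T x) y : R[i]^o).

End OperatorAlgebras.

Definition directed I (le : I -> I -> Prop) :=
  [/\ inhabited I,
      forall i, le i i,
      forall i j k, le i j -> le j k -> le i k
    & forall i j, exists2 k, le i k & le j k].

Definition tails I (le : I -> I -> Prop) : set_system I :=
  filter_from [set: I] (fun i => [set j | le i j]).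

(* A map defined on a set A of operators is given as a function on the whole of
   B(H), about which only the values on A are constrained or used. *)
Section Maps.
Variables (R : realType) (H K : hilbertType R).
Implicit Types (A B M : set 'B(H)) (f sigma psi : 'B(H) -> 'B(K)).

Definition linear_on A f :=
  forall k, {in A &, forall a b, f (k *: a + b) = k *: f a + f b}.

Definition multiplicative_on A f := {in A &, {morph f : a b / a * b}}.

Definition star_representation A sigma :=
  [/\ linear_on A sigma,
      multiplicative_on A sigma,
      {in A, {morph sigma : a / adj a}}
    & sigma 1 = 1].

Definition completely_positive A psi :=
  forall n (a : 'M['B(H)]_n), (forall i j, A (a i j)) ->
    positive_mx a -> positive_mx (map_mx psi a).

Definition ucp A psi :=
  [/\ linear_on A psi, psi 1 = 1 & completely_positive A psi].

Definition unique_extension_property M sigma :=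
  forall psi, ucp (cstar M) psi -> {in M, psi =1 sigma} ->
    {in cstar M, psi =1 sigma}.

Definition approximate_unique_extension_property M sigma :=
  forall psi, ucp (cstar M) psi -> {in M, psi =1 sigma} ->
    exists (I : Type) (le : I -> I -> Prop) (u : I -> 'B(K)),
      [/\ directed le,
          forall i, unitary (u i)
        & {in cstar M, forall t,
             wot_cvg (tails le) (fun i => adj (u i) * psi t * u i) (sigma t)}].

Definition kernel_on A f : set 'B(H) := [set a | A a /\ f a = 0].

Definition isometric_on A f := {in A, forall a, `|f a| = `|a|}.

End Maps.

Definition conditional_expectation (R : realType) (H : hilbertType R)
    (B A : set 'B(H)) (E : 'B(H) -> 'B(H)) :=
  [/\ cstar_subalgebra A, cstar_subalgebra B & A `<=` B] /\
  [/\ linear_on B E,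
      {in B, forall b, `|E b| <= `|b|},
      E @` B = A
    & {in B, forall b, E (E b) = E b}].

(* Main.v *)
(** If [psi] agrees with [pi] on [M], the approximate unique extension property
    gives unitaries with [u^* psi(t) u -> pi(t)] weakly. The Schwarz inequality for
    [psi] upgrades this to strong convergence, so the operators [b] for which both
    [u^* b u] and [u^* b^* u] converge strongly, with limit in [Im pi], form a
    C*-algebra containing [Im psi], and [Gamma b := lim u^* b u] is multiplicative
    on it. For (ii), a ucp map [f] that agrees with [Gamma] on [Im psi] satisfies
    [f (psi(t)^* psi(t)) <= f (psi (t^* t)) = f (psi t)^* f (psi t)], so that
    [Im psi] lies in its multiplicative domain. For (iii), [b - Gamma b] lies in
    any closed ideal containing [Im (psi - pi)], first for [b] in [Im psi], then
    for all [b]. That [Im pi] is norm closed is obtained without functional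
    calculus, from the approximate lifting [a (1 + a^* a)^-1] of [pi a]. *)
Require Import Defs.
From HB Require Import structures.
From mathcomp Require Import all_boot all_order all_algebra.
From mathcomp Require Import all_classical all_reals all_analysis.
From mathcomp Require Import sesquilinear complex.
From mathcomp Require Import ring lra.
Set Implicit Arguments.
Unset Strict Implicit.
Unset Printing Implicit Defensive.
Import Order.TTheory GRing.Theory Num.Theory.
Import numFieldNormedType.Exports.
Local Open Scope classical_set_scope.
Local Open Scope ring_scope.
Local Open Scope complex_scope.

(** * Sequences in normed spaces *)

(** Strong convergence is wanted because weak limits do not respect products; for strong limits a
    bound on the left factor suffices, and conjugation by unitaries supplies it. Closedness of
    [Im pi] keeps norm limits of values of [Gamma] inside [Im pi]. In (ii) the displayed inequality
    is the reverse of the Schwarz inequality for [f]; it arises because [Gamma] composed with [psi]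
    is the multiplicative map [pi]. In (iii) an element [b] of the kernel equals [b - Gamma b].
    Estimates are made with the real-valued [rnorm] and [rdot], so that they are real polynomial
    inequalities. *)

Section NormedSpaces.
Variables (R : realType) (V : normedModType R[i]).
Implicit Types (x y z : V) (A : set V) (u : nat -> V).

Lemma rnorm0 : rnorm (0 : V) = 0.
Proof. by rewrite /rnorm normr0. Qed.

Lemma rnorm_eq0 x : rnorm x = 0 -> x = 0.
Proof. by move=> x0; apply: normr0_eq0; rewrite -rnormE x0. Qed.

Lemma rnormN x : rnorm (- x) = rnorm x.
Proof. by rewrite /rnorm normrN. Qed.

Lemma rdistC x y : rnorm (x - y) = rnorm (y - x).
Proof. by rewrite -rnormN opprB. Qed.

Lemma ler_rnormD x y : rnorm (x + y) <= rnorm x + rnorm y.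
Proof. by rewrite -lecR real_complexD !rnormE ler_normD. Qed.

Lemma ler_rdistD z x y : rnorm (x - y) <= rnorm (x - z) + rnorm (z - y).
Proof. by rewrite (le_trans _ (ler_rnormD _ _))// addrA subrK. Qed.

Lemma rnormZ (k : R[i]) x : rnorm (k *: x) = rnorm (k : R[i]^o) * rnorm x.
Proof. by apply: complexI; rewrite real_complexM !rnormE normrZ. Qed.

Lemma rnorm_real (k : R) : 0 <= k -> rnorm (k%:C : R[i]^o) = k.
Proof. by move=> k0; rewrite /rnorm ger0_norm ?ler0c. Qed.

Lemma rnormZr (k : R) x : 0 <= k -> rnorm (k%:C *: x) = k * rnorm x.
Proof. by move=> k0; rewrite rnormZ rnorm_real. Qed.

(** A positive radius in [R[i]] is automatically real, so balls of complex radius reduce to real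
    ones. *)
Lemma rnorm_closedP A : closed A <->
  forall x, (forall e : R, 0 < e -> exists2 y, A y & rnorm (x - y) < e) -> A x.
Proof.
split=> [clA x Ax|clA x].
  apply: clA => B /nbhs_ballP[e /= e0 eB].
  have Re0 : 0 < complex.Re e by rewrite -ltcR RRe_real// gtr0_real.
  have [y Ay xy] := Ax _ Re0; exists y; split => //; apply: eB.
  rewrite -ball_normE /ball_ /=.
  by rewrite -rnormE -(RRe_real (gtr0_real e0)) ltcR.
move=> Ax; apply: clA => e e0.
have [|y [Ay]] := Ax (ball x e%:C).
  by apply: nbhsx_ballx; rewrite ltcR.
rewrite -ball_normE /ball_ /= -rnormE ltcR => xy.
by exists y.
Qed.

Definition rcauchy u := forall e : R, 0 < e ->
  exists N, forall m n, (N <= m)%N -> (N <= n)%N -> rnorm (u m - u n) <= e.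

Definition rlim u x := forall e : R, 0 < e ->
  exists N, forall n, (N <= n)%N -> rnorm (x - u n) <= e.

End NormedSpaces.

Lemma invS_lt (R : realType) (e : R) : 0 < e ->
  exists N, forall n, (N <= n)%N -> n.+1%:R^-1 < e.
Proof.
move=> e0; have [N _ NP] := @near_infty_natSinv_lt R (PosNum e0).
by exists N => n Nn; exact: NP.
Qed.

Lemma rcauchy_lim (R : realType) (V : completeNormedModType R[i]) (u : nat -> V) :
  rcauchy u -> exists x, rlim u x.
Proof.
move=> cu; have /cauchy_cvgP ul : cauchy (u @ \oo).
  apply/cauchy_ballP => e e0.
  have Re0 : 0 < complex.Re e / 2.
    by rewrite divr_gt0// -ltcR RRe_real// gtr0_real.
  have [N NP] := cu _ Re0.
  exists ([set u n | n in [set n | (N <= n)%N]],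
          [set u n | n in [set n | (N <= n)%N]]).
    by split; exists N => // n Nn; exists n.
  move=> [x y] [/= [m Nm <-] [n Nn <-]].
  rewrite -ball_normE /ball_ /= -rnormE -(RRe_real (gtr0_real e0)) ltcR.
  rewrite (le_lt_trans (NP _ _ Nm Nn))// ltr_pdivrMr// ltr_pMr ?ltr1n//.
  by rewrite -ltcR RRe_real// gtr0_real.
exists (lim (u @ \oo)) => e e0.
have e0' : 0 < e%:C by rewrite ltcR.
have /cvgrPdist_le /(_ _ e0')[N _ NP] := ul.
by exists N => n Nn; rewrite -lecR rnormE; exact: NP.
Qed.

(** * Hilbert spaces *)

Lemma Re_mulc (R : realType) (k z : R[i]) :
  complex.Re (k * z) = complex.Re k * complex.Re z - complex.Im k * complex.Im z.
Proof. by case: k z => a b [c d]. Qed.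

Lemma Im_mulc (R : realType) (k z : R[i]) :
  complex.Im (k * z) = complex.Re k * complex.Im z + complex.Im k * complex.Re z.
Proof. by case: k z => a b [c d]. Qed.

Lemma Re_addc (R : realType) (k z : R[i]) :
  complex.Re (k + z) = (complex.Re k : R) + (complex.Re z : R).
Proof. by case: k z => a b [c d]. Qed.

Lemma Re_ge0 (R : realType) (z : R[i]) : 0 <= z -> 0 <= (complex.Re z : R).
Proof. by rewrite lecE => /andP[]. Qed.

Section RealInnerProduct.
Variables (R : realType) (H : hilbertType R).
Implicit Types (x y z : H).

Definition rdot x y : R := complex.Re (dot x y).

Lemma rdotDl x y z : rdot (x + y) z = rdot x z + rdot y z.
Proof. by rewrite /rdot linearDl Re_addc. Qed.

Lemma rdotDr x y z : rdot z (x + y) = rdot z x + rdot z y.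
Proof. by rewrite /rdot linearDr Re_addc. Qed.

Lemma dotZl k x y : dot (k *: x) y = k * dot x y.
Proof. exact: linearZl_LR. Qed.

Lemma dotZr k x y : dot x (k *: y) = k^* * dot x y.
Proof. exact: linearZr_LR. Qed.

Lemma dotDl x y z : dot (x + y) z = dot x z + dot y z.
Proof. exact: linearDl. Qed.

Lemma dotDr x y z : dot z (x + y) = dot z x + dot z y.
Proof. exact: linearDr. Qed.

Lemma dotC x y : dot x y = (dot y x)^*.
Proof. by rewrite hermC expr0 mul1r. Qed.

Lemma rdotC x y : rdot x y = rdot y x.
Proof. by rewrite /rdot dotC; case: (dot y x). Qed.

Lemma rdotZl (k : R) x y : rdot (k%:C *: x) y = k * rdot x y.
Proof.
by rewrite /rdot dotZl Re_mulc/= mul0r subr0.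
Qed.

Lemma rdotZr (k : R) x y : rdot x (k%:C *: y) = k * rdot x y.
Proof. by rewrite rdotC rdotZl rdotC. Qed.

Lemma rdotNl x y : rdot (- x) y = - rdot x y.
Proof. by rewrite -[in LHS]scaleN1r -[-1](rmorphN1 (real_complex R)) rdotZl mulN1r. Qed.

Lemma rdotNr x y : rdot x (- y) = - rdot x y.
Proof. by rewrite rdotC rdotNl rdotC. Qed.

Lemma rdotBl x y z : rdot (x - y) z = rdot x z - rdot y z.
Proof. by rewrite rdotDl rdotNl. Qed.

Lemma rdotBr x y z : rdot z (x - y) = rdot z x - rdot z y.
Proof. by rewrite rdotDr rdotNr. Qed.

Lemma rdotZi x y : rdot ('i *: x) ('i *: y) = rdot x y.
Proof.
rewrite /rdot dotZl dotZr Re_mulc Re_mulc Im_mulc/=.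
by rewrite !mul0r !sub0r add0r mul1r mulN1r opprK.
Qed.

(** Conjugate linearity on the right moves the imaginary part of [dot x y] into the real part when
    [y] is multiplied by ['i]; complex identities thus follow from real ones. *)
Lemma dotE x y : dot x y = rdot x y +i* rdot x ('i *: y).
Proof.
rewrite /rdot dotZr Re_mulc/= mul0r sub0r mulNr mul1r opprK.
by case: (dot x y).
Qed.

Lemma rdotxx x : rdot x x = rnorm x ^+ 2.
Proof. by rewrite /rdot dotxx -rnormE -rmorphXn. Qed.

Lemma dotxxE x : dot x x = (rnorm x ^+ 2)%:C.
Proof. by rewrite dotxx -rnormE rmorphXn. Qed.

Lemma rnormD_sqr x y :
  rnorm (x + y) ^+ 2 = rnorm x ^+ 2 + rnorm y ^+ 2 + 2 * rdot x y.
Proof. rewrite -!rdotxx rdotDl !rdotDr (rdotC y x); ring. Qed.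

Lemma rnormB_sqr x y :
  rnorm (x - y) ^+ 2 = rnorm x ^+ 2 + rnorm y ^+ 2 - 2 * rdot x y.
Proof. rewrite -!rdotxx rdotBl !rdotBr (rdotC y x); ring. Qed.

(** Cauchy-Schwarz, from the squared norm of [|y| x - |x| y]; zero vectors are set aside so that
    [rnorm x * rnorm y] can be cancelled. *)
Lemma rdot_le x y : rdot x y <= rnorm x * rnorm y.
Proof.
have [->|x0] := eqVneq x 0.
  by rewrite /rdot linear0l rnorm0 mul0r.
have [->|y0] := eqVneq y 0.
  by rewrite /rdot linear0r rnorm0 mulr0.
have rn_gt0 z : z != 0 -> 0 < rnorm z.
  move=> z0; rewrite lt_neqAle rnorm_ge0 andbT eq_sym.
  by apply: contra_neq z0; exact: rnorm_eq0.
have xy0 : 0 < rnorm x * rnorm y by rewrite mulr_gt0 ?rn_gt0.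
have := sqr_ge0 (rnorm ((rnorm y)%:C *: x - (rnorm x)%:C *: y)).
rewrite rnormB_sqr !rnormZr ?rnorm_ge0// rdotZl rdotZr.
set a := rnorm x in xy0 *; set b := rnorm y in xy0 *; set c := rdot x y => h.
rewrite -(ler_pM2l xy0); nra.
Qed.

Lemma normr_rdot_le x y : `|rdot x y| <= rnorm x * rnorm y.
Proof. by rewrite ler_norml rdot_le andbT lerNl -rdotNl -(rnormN x) rdot_le. Qed.

Lemma rdot0r x : rdot x 0 = 0.
Proof. by rewrite -(subrr x) rdotBr subrr. Qed.

Lemma rdot_inj x y : (forall z, rdot z x = rdot z y) -> x = y.
Proof.
move=> xy; apply/eqP; rewrite -subr_eq0; apply/eqP/rnorm_eq0/eqP.
by rewrite -sqrf_eq0 -rdotxx rdotBr xy subrr.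
Qed.

End RealInnerProduct.

(* The representing vector minimises [rnorm x ^+ 2 - 2 * f x]; the
   parallelogram identity makes minimising sequences Cauchy. *)
Lemma riesz (R : realType) (H : hilbertType R) (f : H -> R) (C : R) :
  (forall x y, f (x + y) = f x + f y) -> (forall k x, f (k%:C *: x) = k * f x) ->
  (forall x, `|f x| <= C * rnorm x) ->
  exists y, forall x, f x = rdot x y.
Proof.
move=> fD fZ fC.
pose g x := rnorm x ^+ 2 - 2 * f x.
have g_lb x : - C ^+ 2 <= g x.
  have := fC x; rewrite ler_norml => /andP[_]; rewrite /g.
  move: (rnorm x) (f x) => a b ab; have := sqr_ge0 (a - C); nra.
pose d := inf (range g).
have hi : has_inf (range g).
  by split; [exists (g 0), 0 | exists (- C ^+ 2) => _ [x _ <-]].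
have dg x : d <= g x by apply: ge_inf; [exact: hi.2|exists x].
pose e n : R := n.+1%:R^-1.
have e0 n : 0 < e n by rewrite invr_gt0.
(* The defect is [e n ^+ 2], so that the parallelogram identity bounds distances linearly in
   [e m + e n]. *)
have /choice[u uP] : forall n, exists x, g x < d + e n ^+ 2.
  move=> n; have [_ [x _ <-] gx] := inf_adherent (exprn_gt0 2 (e0 n)) hi.
  by exists x.
have gmid x y : rnorm (x - y) ^+ 2 =
    2 * g x + 2 * g y - 4 * g ((2^-1)%:C *: (x + y)).
  rewrite /g rnormZr ?invr_ge0// fZ fD exprMn rnormB_sqr rnormD_sqr.
  by field.
have ul m n : rnorm (u m - u n) <= 2 * (e m + e n).
  rewrite -(@ler_pXn2r _ 2) ?nnegrE ?rnorm_ge0 ?mulr_ge0 ?addr_ge0 ?ltW//.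
  rewrite gmid; have := dg ((2^-1)%:C *: (u m + u n)).
  have := uP m; have := uP n; have := e0 m; have := e0 n; nra.
have [y yl] : exists y, rlim u y.
  apply: rcauchy_lim => b b0.
  have b4 : 0 < b / 4 by rewrite divr_gt0.
  have [N NP] := invS_lt b4; exists N => m n /NP Nm /NP Nn.
  apply: (le_trans (ul _ _)).
  move: Nm Nn; rewrite -/(e m) -/(e n); move: (e m) (e n) => em en; lra.
(* First variation: moving from [u n] by [t v] lowers [g] by less than [e n ^+ 2], so a quadratic in
   [t] is nonnegative; its value at the minimiser bounds the error. *)
have ue v n : `|rdot v (u n) - f v| <= e n * rnorm v.
  have var t : 0 <= t ^+ 2 * rnorm v ^+ 2 + 2 * t * (rdot v (u n) - f v) + e n ^+ 2.
    have := dg (u n + t%:C *: v); have := uP n; rewrite /g fD fZ rnormD_sqr rdotZr.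
    rewrite (_ : rnorm (t%:C *: v) ^+ 2 = t ^+ 2 * rnorm v ^+ 2); last first.
      by rewrite -!rdotxx rdotZl rdotZr mulrA -expr2.
    rewrite (rdotC v); lra.
  have nv0 := rnorm_ge0 v; have en0 := e0 n.
  rewrite -(@ler_pXn2r _ 2) ?nnegrE ?mulr_ge0// ?(ltW en0)// real_normK ?num_real//.
  move: var; set a := rdot v (u n) - f v; set c := rnorm v => var.
  have [c0|c0] := eqVneq c 0.
    suff -> : a = 0 by rewrite expr0n/= sqr_ge0.
    rewrite /a (rnorm_eq0 c0); apply/eqP.
    rewrite /rdot linear0l/= sub0r oppr_eq0 -[0](scale0r (0 : H)).
    by rewrite -[0 in X in f X](rmorph0 (real_complex R)) fZ mul0r.
  have c2 : 0 < c ^+ 2 by rewrite exprn_gt0// lt_neqAle eq_sym c0.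
  have := var (- a / c ^+ 2).
  rewrite (_ : _ + _ + _ = (e n ^+ 2 * c ^+ 2 - a ^+ 2) / c ^+ 2); last by field.
  by rewrite pmulr_lge0 ?invr_gt0// subr_ge0 exprMn.
exists y => v; apply/eqP; rewrite -subr_eq0 -normr_le0 leNgt; apply/negP => p0.
set p := `|_| in p0.
have nv1 : 0 < rnorm v + 1 by rewrite ltr_wpDl// rnorm_ge0.
(* The errors from [y - u n] and from [ue] are each at most [rnorm v] times this quantity, in total
   less than [p]. *)
have q0 : 0 < p / (4 * (rnorm v + 1)) by rewrite divr_gt0// mulr_gt0.
have [N1 h1] := yl _ q0; have [N2 h2] := invS_lt q0.
have := ue v (maxn N1 N2); rewrite -/(e _).
have := normr_rdot_le v (y - u (maxn N1 N2)).
have : p <= `|rdot v (y - u (maxn N1 N2))| + `|rdot v (u (maxn N1 N2)) - f v|.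
  by rewrite /p distrC (le_trans _ (ler_normD _ _))// rdotBr addrA subrK.
move: (h1 _ (leq_maxl N1 N2)) (h2 _ (leq_maxr N1 N2)).
move: (rnorm_ge0 (y - u (maxn N1 N2))) (e0 (maxn N1 N2)); rewrite -/(e _).
move: (e _) (rnorm (y - _)) => en r.
rewrite ler_pdivlMr ?mulr_gt0// ltr_pdivlMr ?mulr_gt0//.
have := rnorm_ge0 v; move: (rnorm v) p0 nv1 => w p0 nv1 w0 tri rn en' h3 h4 r0 en0.
nra.
Qed.

(** * Bounded operators *)

Section SequenceLimits.
Variables (R : realType) (V : normedModType R[i]).
Implicit Types (x y : V) (u v : nat -> V).

Lemma rlim_unique u x y : rlim u x -> rlim u y -> x = y.
Proof.
move=> ux uy; apply/eqP; rewrite -subr_eq0; apply/eqP/rnorm_eq0/eqP.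
rewrite eq_le rnorm_ge0 andbT; apply/ler_addgt0Pr => e e0; rewrite add0r.
have e2 : 0 < e / 2 by rewrite divr_gt0.
have [N h] := ux _ e2; have [N' h'] := uy _ e2.
rewrite (le_trans (ler_rdistD (u (maxn N N')) _ _))// (splitr e) lerD//.
  by rewrite h ?leq_maxl.
by rewrite rdistC h' ?leq_maxr.
Qed.

Lemma rlimP (k : R[i]) u v x y : rlim u x -> rlim v y ->
  rlim (fun n => k *: u n + v n) (k *: x + y).
Proof.
move=> ux vy e e0; have e2 : 0 < e / 2 by rewrite divr_gt0.
have k1 : 0 < rnorm (k : R[i]^o) + 1 by rewrite ltr_wpDl ?rnorm_ge0.
have [N h] := ux _ (divr_gt0 e2 k1); have [N' h'] := vy _ e2.
exists (maxn N N') => n; rewrite geq_max => /andP[/h + /h'].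
rewrite ler_pdivlMr// opprD addrACA -scalerBr => hx hy.
rewrite (le_trans (ler_rnormD _ _))// rnormZ.
have := rnorm_ge0 (x - u n); lra.
Qed.

End SequenceLimits.

Section Operators.
Variables (R : realType) (H : hilbertType R).
Implicit Types (S T : 'B(H)) (x y : H).

Lemma bopBE S T x : (S - T) x = S x - T x. Proof. by []. Qed.
Lemma bopNE T x : (- T) x = - T x. Proof. by []. Qed.
Lemma bopME S T x : (S * T) x = S (T x). Proof. by []. Qed.
Lemma bop1E x : (1 : 'B(H)) x = x. Proof. by []. Qed.

Lemma bopB T x y : T (x - y) = T x - T y. Proof. exact: linearB. Qed.

Lemma bopZMl k S T : (k *: S) * T = k *: (S * T).
Proof. exact: bopP. Qed.

Lemma bopZMr k S T : S * (k *: T) = k *: (S * T).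
Proof. by apply: bopP => x; rewrite bopME !bopZE bopZ. Qed.

Lemma rnorm_op_ub T x : rnorm (T x) <= rnorm T * rnorm x.
Proof. by rewrite -lecR real_complexM !rnormE; exact: opnorm_ub. Qed.

Lemma rnorm_op_le T (M : R) : 0 <= M ->
  (forall x, rnorm (T x) <= M * rnorm x) -> rnorm T <= M.
Proof.
move=> M0 TM; apply: opnorm_le => // x.
by rewrite -!rnormE -real_complexM lecR.
Qed.

Lemma rnorm_opM S T : rnorm (S * T) <= rnorm S * rnorm T.
Proof.
apply: rnorm_op_le => [|x]; first by rewrite mulr_ge0 ?rnorm_ge0.
rewrite bopME (le_trans (rnorm_op_ub _ _))// -mulrA.
by rewrite ler_wpM2l ?rnorm_ge0// rnorm_op_ub.
Qed.

Lemma rnorm_op1 : rnorm (1 : 'B(H)) <= 1.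
Proof. by apply: rnorm_op_le => // x; rewrite mul1r. Qed.

Lemma bop_of (f : H -> H) (M : R) : linear f ->
  (forall x, rnorm (f x) <= M * rnorm x) -> exists T, T =1 f.
Proof.
move=> fl fM; suff fb : f \in @bounded_linear R H by exists (Bop fb).
apply/asboolP; split => //; exists M => x.
by rewrite -!rnormE -real_complexM lecR.
Qed.

Lemma rdotiC x y : rdot ('i *: x) y = - rdot x ('i *: y).
Proof.
by rewrite -(rdotZi x) scalerA -expr2 sqr_i scaleN1r rdotNr opprK.
Qed.

(** Riesz is applied to the real functional [x |-> rdot (T x) y]; as [T] commutes with ['i],
    equality of real parts lifts to [dot]. *)
Lemma adjoint_exists T :
  exists S : 'B(H), forall x y, dot (T x) y = dot x (S y).
Proof.
have /choice[S SP] : forall y, exists z, forall x, rdot (T x) y = rdot x z.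
  move=> y; apply: (@riesz _ _ _ (rnorm T * rnorm y)) => [x x'|k x|x].
  - by rewrite bopD rdotDl.
  - by rewrite bopZ rdotZl.
  - rewrite (le_trans (normr_rdot_le _ _))// mulrAC.
    by rewrite ler_wpM2r ?rnorm_ge0// rnorm_op_ub.
have dS x y : dot (T x) y = dot x (S y).
  rewrite !dotE SP; congr (_ +i* _).
  by apply: oppr_inj; rewrite -!rdotiC -bopZ SP.
have dot_inj x y : (forall z, dot z x = dot z y) -> x = y.
  by move=> xy; apply: rdot_inj => z; rewrite /rdot xy.
have [|y|S' S'E] := @bop_of S (rnorm T).
- move=> k x y; apply: dot_inj => z.
  by rewrite -dS !dotDr !dotZr !dS.
- have [->|y0] := eqVneq (rnorm (S y)) 0; first by rewrite mulr_ge0 ?rnorm_ge0.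
  have y1 : 0 < rnorm (S y) by rewrite lt_neqAle eq_sym y0 rnorm_ge0.
  rewrite -(ler_pM2l y1) -expr2 -rdotxx -SP (le_trans (rdot_le _ _))//.
  by rewrite mulrA (mulrC (rnorm (S y))) ler_wpM2r ?rnorm_ge0// rnorm_op_ub.
- by exists S' => x y; rewrite S'E.
Qed.

Lemma dot_adj T x y : dot (T x) y = dot x (adj T y).
Proof.
have [S SP] := adjoint_exists T.
have : [set S : 'B(H) | forall x y, dot (T x) y = dot x (S y)] (adj T).
  by apply: xgetPex; exists S.
exact.
Qed.

Lemma rdot_adj T x y : rdot (T x) y = rdot x (adj T y).
Proof. by rewrite /rdot dot_adj. Qed.

Lemma rdot_adjl T x y : rdot (adj T x) y = rdot x (T y).
Proof. by rewrite rdotC -rdot_adj rdotC. Qed.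

Lemma adj_unique S T : (forall x y, rdot (T x) y = rdot x (S y)) -> adj T = S.
Proof.
by move=> TS; apply: bopP => y; apply: rdot_inj => x; rewrite -rdot_adj TS.
Qed.

Lemma adjK T : adj (adj T) = T.
Proof. by apply: adj_unique => x y; rewrite rdot_adjl. Qed.

Lemma adjM S T : adj (S * T) = adj T * adj S.
Proof. by apply: adj_unique => x y; rewrite !bopME !rdot_adj. Qed.

Lemma adjP (k : R[i]) S T : adj (k *: S + T) = k^* *: adj S + adj T.
Proof.
apply: bopP => y; apply: rdot_inj => x.
rewrite -rdot_adj !bopDE !bopZE /rdot dotDl dotDr dotZl dotZr conjCK.
by rewrite !dot_adj.
Qed.

Lemma adj1 : adj (1 : 'B(H)) = 1.
Proof. exact: adj_unique. Qed.

Lemma adjD S T : adj (S + T) = adj S + adj T.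
Proof. by rewrite -[S]scale1r adjP conjC1 !scale1r. Qed.

Lemma adjN T : adj (- T) = - adj T.
Proof. by apply: adj_unique => x y; rewrite !bopNE rdotNl rdotNr rdot_adj. Qed.

Lemma adjB S T : adj (S - T) = adj S - adj T.
Proof. by rewrite adjD adjN. Qed.

Lemma adjZr (k : R) T : adj (k%:C *: T) = k%:C *: adj T.
Proof. by apply: adj_unique => x y; rewrite !bopZE rdotZl rdotZr rdot_adj. Qed.

Lemma rnorm_adj_le T : rnorm (adj T) <= rnorm T.
Proof.
apply: rnorm_op_le => [|y]; first exact: rnorm_ge0.
have [->|y0] := eqVneq (rnorm (adj T y)) 0; first by rewrite mulr_ge0 ?rnorm_ge0.
have y1 : 0 < rnorm (adj T y) by rewrite lt_neqAle eq_sym y0 rnorm_ge0.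
rewrite -(ler_pM2l y1) -expr2 -rdotxx -rdot_adj (le_trans (rdot_le _ _))//.
by rewrite mulrA (mulrC (rnorm (adj T y))) ler_wpM2r ?rnorm_ge0// rnorm_op_ub.
Qed.

Lemma rnorm_adj T : rnorm (adj T) = rnorm T.
Proof. by apply/eqP; rewrite eq_le rnorm_adj_le -{1}[T]adjK rnorm_adj_le. Qed.

(** The nontrivial half of the C*-identity: [|T x|^2] is [<T^* T x, x>], to which Cauchy-Schwarz
    applies. *)
Lemma rnorm_cstar T : rnorm T ^+ 2 <= rnorm (adj T * T).
Proof.
rewrite -[leRHS]sqr_sqrtr ?rnorm_ge0// ler_pXn2r ?nnegrE ?rnorm_ge0 ?sqrtr_ge0//.
apply: rnorm_op_le => [|x]; first exact: sqrtr_ge0.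
rewrite -(@ler_pXn2r _ 2) ?nnegrE ?mulr_ge0 ?rnorm_ge0 ?sqrtr_ge0//.
rewrite exprMn sqr_sqrtr ?rnorm_ge0// -rdotxx rdot_adj -bopME.
rewrite (le_trans (rdot_le _ _))// mulrC expr2 mulrA.
by rewrite ler_wpM2r ?rnorm_ge0// rnorm_op_ub.
Qed.

Lemma bop_complete (u : nat -> 'B(H)) : rcauchy u -> exists T, rlim u T.
Proof.
move=> cu.
have /choice[f fP] : forall x, exists y, rlim (fun n => u n x) y.
  move=> x; apply: rcauchy_lim => e e0.
  have x1 : 0 < rnorm x + 1 by rewrite ltr_wpDl ?rnorm_ge0.
  have [N h] := cu _ (divr_gt0 e0 x1); exists N => m n Nm Nn.
  rewrite -bopBE (le_trans (rnorm_op_ub _ _))//.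
  rewrite (@le_trans _ _ (e / (rnorm x + 1) * rnorm x))//.
    by rewrite ler_wpM2r ?rnorm_ge0// h.
  by rewrite mulrAC ler_pdivrMr// ler_wpM2l ?ltW// ltrDl.
(* The first index tends to infinity in the Cauchy estimate, uniformly in [x]; this gives both the
   boundedness of [f] and norm convergence. *)
have fu e N : (forall m n, (N <= m)%N -> (N <= n)%N -> rnorm (u m - u n) <= e) ->
    forall n x, (N <= n)%N -> rnorm (f x - u n x) <= e * rnorm x.
  move=> Ne n x Nn; apply/ler_addgt0Pr => d d0; have [K h] := fP x _ d0.
  rewrite [leRHS]addrC (le_trans (ler_rdistD (u (maxn N K) x) _ _))// lerD//.
    by rewrite h ?leq_maxr.
  rewrite -bopBE (le_trans (rnorm_op_ub _ _))// ler_wpM2r ?rnorm_ge0//.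
  by rewrite Ne ?leq_maxl.
have [N1 N1P] := cu _ ltr01.
have [|x|T TE] := @bop_of f (1 + rnorm (u N1)).
- move=> k x y; apply: (rlim_unique (fP _)) => e e0.
  have [N h] := rlimP k (fP x) (fP y) e0; exists N => n Nn.
  by rewrite bopD bopZ h.
- rewrite -[f x](subrK (u N1 x)) (le_trans (ler_rnormD _ _))// mulrDl lerD//.
    exact: (fu _ _ N1P).
  exact: rnorm_op_ub.
exists T => e e0; have [N NP] := cu _ e0; exists N => n Nn.
apply: rnorm_op_le => [|x]; first exact: ltW.
by rewrite bopBE TE (fu _ _ NP).
Qed.

End Operators.

(** * C*-subalgebras and inverses *)

Section GeometricSequences.
Variables (R : realType) (V : normedModType R[i]).
Implicit Types (x : V) (u : nat -> V).

Lemma geometric_cauchy (C q : R) u : 0 <= q < 1 ->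
  (forall n, rnorm (u n.+1 - u n) <= C * q ^+ n) -> rcauchy u.
Proof.
move=> /andP[q0 q1] uq.
have C0 : 0 <= C by have := uq 0%N; rewrite expr0 mulr1; exact/le_trans/rnorm_ge0.
have q1' : 0 < 1 - q by rewrite subr_gt0.
have un n k : rnorm (u (n + k)%N - u n) <= C * q ^+ n * (1 - q ^+ k) / (1 - q).
  elim: k => [|k IH]; first by rewrite addn0 subrr rnorm0 expr0 subrr mulr0 mul0r.
  rewrite (le_trans (ler_rdistD (u (n + k)%N) _ _))//.
  rewrite addnS (le_trans (lerD (uq _) IH))// exprD exprS.
  by rewrite le_eqVlt; apply/orP; left; apply/eqP; field; rewrite gt_eqF.
have unn n m : (n <= m)%N -> rnorm (u m - u n) <= C / (1 - q) * q ^+ n.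
  move=> /subnKC <-; rewrite (le_trans (un _ _))// mulrAC (mulrAC C).
  rewrite ler_piMr ?mulr_ge0 ?invr_ge0 ?exprn_ge0 ?(ltW q1')//.
  by rewrite gerBl exprn_ge0.
move=> e e0.
have D0 : 0 < C / (1 - q) + 1 by rewrite ltr_wpDl// divr_ge0// ltW.
have q1n : `|q| < 1 by rewrite ger0_norm.
have e1 : 0 < e / 2 / (C / (1 - q) + 1) by rewrite !divr_gt0.
have /cvgrPdist_lt /(_ _ e1)[N _ NP] := cvg_expr q1n.
have qN : C / (1 - q) * q ^+ N <= e / 2.
  have := NP _ (leqnn N); rewrite sub0r normrN ger0_norm ?exprn_ge0//.
  rewrite ltr_pdivlMr// => /ltW/(le_trans _)->//.
  by rewrite mulrC ler_wpM2l ?exprn_ge0// lerDl.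
exists N => m n Nm Nn; rewrite (le_trans (ler_rdistD (u N) _ _))//.
rewrite (splitr e) lerD// ?(le_trans _ qN)// ?unn//.
by rewrite rdistC unn.
Qed.

Lemma rlimS u x : rlim u x -> rlim (fun n => u n.+1) x.
Proof.
by move=> ux e /ux[N h]; exists N => n Nn; apply: h; exact: leqW.
Qed.

Lemma rlim_lipschitz (W : normedModType R[i]) (f : V -> W) (C : R) u x :
  (forall n, rnorm (f x - f (u n)) <= C * rnorm (x - u n)) ->
  rlim u x -> rlim (fun n => f (u n)) (f x).
Proof.
move=> fC ux e e0; have C1 : 0 < `|C| + 1 by rewrite ltr_wpDl.
have [N h] := ux _ (divr_gt0 e0 C1); exists N => n /h.
rewrite ler_pdivlMr// => xu; rewrite (le_trans (fC n))// (le_trans _ xu)//.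
by rewrite mulrC ler_wpM2l ?rnorm_ge0// (le_trans (ler_norm C))// lerDl.
Qed.

End GeometricSequences.

Section CstarSubalgebras.
Variables (R : realType) (H : hilbertType R) (A : set 'B(H)).

Lemma cstar_subalgebra_intro :
  A 0 -> (forall k a b, A a -> A b -> A (k *: a + b)) ->
  (forall a b, A a -> A b -> A (a * b)) -> (forall a, A a -> A (adj a)) ->
  (forall a, (forall e : R, 0 < e -> exists2 b, A b & rnorm (a - b) < e) -> A a) ->
  cstar_subalgebra A.
Proof.
move=> A0 AP AM AJ Acl; split.
- split; first exact: mem_set.
  by move=> k a b /set_mem Aa /set_mem Ab; apply/mem_set/AP.
- by move=> a b /set_mem Aa /set_mem Ab; exact: AM.
- by move=> a /set_mem Aa; exact: AJ.
- by apply/rnorm_closedP.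
Qed.

Hypothesis csA : cstar_subalgebra A.

Lemma cs0 : A 0.
Proof. by case: csA => -[/set_mem]. Qed.

Lemma csP k a b : A a -> A b -> A (k *: a + b).
Proof.
by move=> /mem_set Aa /mem_set Ab; case: csA => -[_ h _ _ _]; apply/set_mem/h.
Qed.

Lemma csM a b : A a -> A b -> A (a * b).
Proof. by move=> /mem_set Aa /mem_set Ab; case: csA => _ h _ _; exact: h. Qed.

Lemma csJ a : A a -> A (adj a).
Proof. by move=> /mem_set Aa; case: csA => _ _ h _; exact: h. Qed.

Lemma cs_closed a :
  (forall e : R, 0 < e -> exists2 b, A b & rnorm (a - b) < e) -> A a.
Proof. by move: a; apply/rnorm_closedP; case: csA. Qed.

Lemma csZ k a : A a -> A (k *: a).
Proof. by move=> Aa; rewrite -[_ *: _]addr0; apply: csP => //; exact: cs0. Qed.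

Lemma csD a b : A a -> A b -> A (a + b).
Proof. by move=> Aa Ab; rewrite -[a]scale1r; exact: csP. Qed.

Lemma csB a b : A a -> A b -> A (a - b).
Proof. by move=> Aa Ab; rewrite addrC -scaleN1r; exact: csP. Qed.

Lemma cs_rlim (u : nat -> 'B(H)) a : (forall n, A (u n)) -> rlim u a -> A a.
Proof.
move=> Au ua; apply: cs_closed => e e0.
have [N h] : exists N, forall n, (N <= n)%N -> rnorm (a - u n) <= e / 2.
  by apply: ua; rewrite divr_gt0.
exists (u N) => //; rewrite (le_lt_trans (h _ (leqnn N)))//.
by rewrite ltr_pdivrMr// ltr_pMr// ltr1n.
Qed.

Hypothesis A1 : A 1.

(** The iterates of [s |-> 1 + k s] from 0 are the partial sums of the Neumann series; they lie in
    [A], and closedness keeps the inverse there. *)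
Lemma cs_neumann (k : 'B(H)) (q : R) : 0 <= q < 1 -> A k -> rnorm k <= q ->
  exists s, [/\ A s, (1 - k) * s = 1 & s * (1 - k) = 1].
Proof.
move=> q01 Ak kq; pose u n : 'B(H) := iter n (fun s : 'B(H) => 1 + k * s) 0.
have [|s us] := @bop_complete _ _ u.
  apply: (@geometric_cauchy _ _ 1 q) => //.
  elim=> [|n IH]; first by rewrite /= mulr0 addr0 subr0 mulr1 rnorm_op1.
  rewrite [u n.+2]/= [in X in _ - X]/= opprD addrACA subrr add0r -mulrBr.
  rewrite (le_trans (rnorm_opM _ _))// exprS mulrCA ler_pM ?rnorm_ge0//.
(* Commutation passes to the limit and makes the inverse two-sided. *)
have ukC n : k * u n = u n * k.
  elim: n => [|n IH]; first by rewrite /= mulr0 mul0r.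
  by rewrite /= mulrDr mulrDl mulr1 mul1r IH !mulrA -IH.
have kus : rlim (fun n => k * u n) (k * s).
  apply: (@rlim_lipschitz _ 'B(H) 'B(H) (fun a : 'B(H) => k * a) (rnorm k) u s _ us) => n.
  by rewrite -mulrBr rnorm_opM.
have skE : k * s = s * k.
  apply: rlim_unique kus _.
  under [X in rlim X]eq_fun do rewrite ukC.
  apply: (@rlim_lipschitz _ 'B(H) 'B(H) (fun a : 'B(H) => a * k) (rnorm k) u s _ us) => n.
  by rewrite -mulrBl mulrC rnorm_opM.
have sE : s = 1 + k * s.
  apply: rlim_unique (rlimS us) _ => e /kus[N h]; exists N => n Nn.
  by rewrite [u n.+1]/= opprD addrACA subrr add0r h.
exists s; split.
- apply: cs_rlim us => n; elim: n => [|n IH]; first exact: cs0.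
  by apply: csD => //; exact: csM.
- by rewrite mulrBl mul1r {1}sE addrK.
- by rewrite mulrBr mulr1 -skE {1}sE addrK.
Qed.

(** Coercivity makes [1 - e c] a strict contraction for a suitable [e > 0], so a Neumann series
    inverts [e c]. *)
Lemma cs_inverse (c : 'B(H)) (d : R) : 0 < d -> A c ->
  (forall x, d * rnorm x ^+ 2 <= rdot (c x) x) ->
  exists s, [/\ A s, c * s = 1 & s * c = 1].
Proof.
move=> d0 Ac cd; pose C := rnorm c + d.
have C0 : 0 < C by rewrite ltr_wpDl ?rnorm_ge0.
(* This [e] minimises [1 - 2 e d + e^2 C^2], which bounds [|1 - e c|^2]; the minimum is
   [1 - d^2 / C^2], nonnegative because [d] is a summand of [C]. *)
pose e := d / C ^+ 2; have e0 : 0 < e by rewrite divr_gt0 ?exprn_gt0.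
have p0 : 0 <= 1 - d ^+ 2 / C ^+ 2.
  rewrite subr_ge0 ler_pdivrMr ?exprn_gt0// mul1r ler_pXn2r ?nnegrE ?(ltW d0) ?(ltW C0)//.
  by rewrite lerDr rnorm_ge0.
pose q := Num.sqrt (1 - d ^+ 2 / C ^+ 2).
have q1 : q < 1.
  by rewrite -[ltRHS]sqrtr1 ltr_sqrt// gtrBl divr_gt0 ?exprn_gt0.
have kE : 1 - (1 - e%:C *: c) = e%:C *: c by rewrite opprB addrC subrK.
have [|||s [As s1 s2]] := @cs_neumann (1 - e%:C *: c) q.
- by rewrite sqrtr_ge0.
- by apply: csB => //; exact: csZ.
- apply: rnorm_op_le => [|x]; first exact: sqrtr_ge0.
  rewrite -(@ler_pXn2r _ 2) ?nnegrE ?mulr_ge0 ?rnorm_ge0 ?sqrtr_ge0//.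
  rewrite exprMn sqr_sqrtr// bopBE bopZE bop1E rnormB_sqr rnormZr ?(ltW e0)//.
  rewrite rdotZr (rdotC x).
  have cx : rnorm (c x) <= C * rnorm x.
    by rewrite (le_trans (rnorm_op_ub _ _))// ler_wpM2r ?rnorm_ge0// lerDl ltW.
  have cx2 : rnorm (c x) ^+ 2 <= C ^+ 2 * rnorm x ^+ 2.
    by rewrite -exprMn ler_pXn2r ?nnegrE ?mulr_ge0 ?rnorm_ge0 ?(ltW C0).
  have cx3 : (e * rnorm (c x)) ^+ 2 <= d ^+ 2 / C ^+ 2 * rnorm x ^+ 2.
    rewrite exprMn (le_trans (ler_wpM2l (sqr_ge0 _) cx2))//.
    rewrite le_eqVlt; apply/orP; left; apply/eqP; rewrite /e; field.
    by rewrite gt_eqF.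
  have := ler_wpM2l (ltW e0) (cd x).
  rewrite (_ : e * (d * _) = d ^+ 2 / C ^+ 2 * rnorm x ^+ 2); last first.
    by rewrite /e; field; rewrite gt_eqF.
  move: cx3; rewrite mulrBl mul1r; lra.
- rewrite kE bopZMl bopZMr in s1 s2.
  exists (e%:C *: s); rewrite bopZMl bopZMr; split => //; exact: csZ.
Qed.

End CstarSubalgebras.

(** * Star representations *)

(** Operator form of [t / (1 + t^2) <= 1/2]: for [x = y + b^* b y], the inequality
    [0 <= |y - b^* b y|^2] gives [4 |b y|^2 <= |x|^2]. *)
Lemma rnorm_bounded_mul_inverse (R : realType) (H : hilbertType R) (b d : 'B(H)) :
  (1 + adj b * b) * d = 1 -> rnorm (b * d) <= 2^-1.
Proof.
move=> bd1; apply: rnorm_op_le => [|x]; first by rewrite invr_ge0.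
have : x = d x + adj b (b (d x)) by rewrite -[LHS](bop1E x) -bd1.
rewrite bopME; move: (d x) => y ->.
have := sqr_ge0 (rnorm (y - adj b (b y))).
rewrite rnormB_sqr -rdot_adj rdotxx => h.
rewrite mulrC ler_pdivlMr//.
rewrite -(@ler_pXn2r _ 2) ?nnegrE ?mulr_ge0 ?rnorm_ge0//.
rewrite rnormD_sqr -rdot_adj rdotxx exprMn; lra.
Qed.

Section StarRepresentations.
Variables (R : realType) (H K : hilbertType R).
Variables (A : set 'B(H)) (s : 'B(H) -> 'B(K)).
Hypotheses (csA : cstar_subalgebra A) (A1 : A 1) (rs : star_representation A s).

Lemma repP k a b : A a -> A b -> s (k *: a + b) = k *: s a + s b.
Proof. by move=> /mem_set Aa /mem_set Ab; case: rs => h _ _ _; exact: h. Qed.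

Lemma repM a b : A a -> A b -> s (a * b) = s a * s b.
Proof. by move=> /mem_set Aa /mem_set Ab; case: rs => _ h _ _; exact: h. Qed.

Lemma repJ a : A a -> s (adj a) = adj (s a).
Proof. by move=> /mem_set Aa; case: rs => _ _ h _; exact: h. Qed.

Lemma rep1 : s 1 = 1.
Proof. by case: rs. Qed.

Lemma repD a b : A a -> A b -> s (a + b) = s a + s b.
Proof. by move=> Aa Ab; rewrite -[a]scale1r repP// !scale1r. Qed.

Lemma repB a b : A a -> A b -> s (a - b) = s a - s b.
Proof. by move=> Aa Ab; rewrite addrC -scaleN1r repP// scaleN1r addrC. Qed.

Lemma rep0 : s 0 = 0.
Proof. by rewrite -(subrr 1) repB// subrr. Qed.

Lemma repZ k a : A a -> s (k *: a) = k *: s a.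
Proof.
by move=> Aa; rewrite -[k *: a]addr0 repP ?rep0 ?addr0//; exact: cs0.
Qed.

(* If [rnorm (s h)] exceeded [rnorm h], then [rnorm (s h) ^+ 2 - h ^+ 2] would be
   invertible in [A], hence so would [rnorm (s h) ^+ 2 - s h ^+ 2], bounding
   [s h] strictly below its norm. *)
Lemma rep_contractive_sa h : A h -> adj h = h -> rnorm (s h) <= rnorm h.
Proof.
move=> Ah hh; rewrite leNgt; apply/negP => hs.
have Ahh : A (h * h) by exact: csM.
set b := s h in hs; have bb : adj b = b by rewrite -repJ// hh.
set B := rnorm b in hs; have B0 : 0 < B by exact: le_lt_trans (rnorm_ge0 h) hs.
pose k : 'B(H) := (B ^+ 2)%:C *: (1 : 'B(H)) - h * h.
have Ak : A k by apply: csB => //; exact: csZ.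
have [||c [Ac kc ck]] := cs_inverse (d := B ^+ 2 - rnorm h ^+ 2) csA A1 _ Ak.
  rewrite subr_gt0 ltr_pXn2r ?nnegrE ?rnorm_ge0//.
  move=> x; rewrite bopBE bopZE bop1E bopME rdotBl rdotZl rdotxx.
  rewrite rdot_adj hh rdotxx mulrBl lerD2l lerN2 -exprMn.
  by rewrite ler_pXn2r ?nnegrE ?mulr_ge0 ?rnorm_ge0// rnorm_op_ub.
have sE : s k = (B ^+ 2)%:C *: (1 : 'B(K)) - b * b.
  by rewrite repB ?repZ ?rep1 ?repM//; exact: csZ.
have cb : s c * ((B ^+ 2)%:C *: (1 : 'B(K)) - b * b) = 1.
  by rewrite -sE -repM// ck rep1.
(* Put [w = |s c|^2]. Expanding [|x|^2 <= w |(B^2 - b^2) x|^2] and using [|b (b x)| <= B |b x|]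
   gives [w B^2 |b x|^2 <= (w B^4 - 1) |x|^2]; adding [|b x|^2 <= B^2 |x|^2] produces [C], which is
   positive even if [w = 0]. *)
pose C := rnorm (s c) ^+ 2 * B ^+ 2 + 1.
have C0 : 0 < C by rewrite ltr_wpDl// mulr_ge0 ?sqr_ge0.
have bx x : C * rnorm (b x) ^+ 2 <= (C * B ^+ 2 - 1) * rnorm x ^+ 2.
  have : rnorm x ^+ 2 <=
      rnorm (s c) ^+ 2 * rnorm (((B ^+ 2)%:C *: (1 : 'B(K)) - b * b) x) ^+ 2.
    rewrite -exprMn ler_pXn2r ?nnegrE ?mulr_ge0 ?rnorm_ge0//.
    by rewrite -[in leLHS](bop1E x) -[in leLHS]cb bopME rnorm_op_ub.
  rewrite bopBE bopZE bop1E bopME rnormB_sqr rnormZr ?sqr_ge0// rdotZl.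
  rewrite -[rdot x _]rdotC rdot_adj bb rdotxx.
  have bbx : rnorm (b (b x)) ^+ 2 <= B ^+ 2 * rnorm (b x) ^+ 2.
    by rewrite -exprMn ler_pXn2r ?nnegrE ?mulr_ge0 ?rnorm_ge0// rnorm_op_ub.
  have bx : rnorm (b x) ^+ 2 <= B ^+ 2 * rnorm x ^+ 2.
    by rewrite -exprMn ler_pXn2r ?nnegrE ?mulr_ge0 ?rnorm_ge0// rnorm_op_ub.
  have := sqr_ge0 (rnorm (s c)); rewrite /C.
  move: (rnorm (s c) ^+ 2) (rnorm (b (b x)) ^+ 2) bbx bx => w z.
  move: (rnorm (b x) ^+ 2) => y; rewrite exprMn.
  move: (rnorm x ^+ 2) (B ^+ 2) => v t bbx bx w0 h1.
  have := ler_wpM2l w0 bbx; lra.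
(* This is the radicand used next; if it were negative, [bx] would force [b = 0], against
   [B > 0]. *)
have CB : 0 <= B ^+ 2 - C^-1.
  have B2 : 0 < B ^+ 2 by rewrite exprn_gt0.
  rewrite leNgt; apply/negP; rewrite subr_lt0 -[C^-1]mul1r ltr_pdivlMr// => BC.
  have : B <= 0.
    apply: rnorm_op_le => // x; rewrite mul0r.
    have : C * rnorm (b x) ^+ 2 <= 0.
      rewrite (le_trans (bx x))// mulr_le0_ge0 ?sqr_ge0//.
      by rewrite subr_le0 mulrC ltW.
    by rewrite pmulr_rle0// exprn_even_le0//= => /eqP->.
  by rewrite leNgt B0.
have : B <= Num.sqrt (B ^+ 2 - C^-1).
  apply: rnorm_op_le => [|x]; first exact: sqrtr_ge0.
  rewrite -(@ler_pXn2r _ 2) ?nnegrE ?mulr_ge0 ?rnorm_ge0 ?sqrtr_ge0//.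
  rewrite exprMn sqr_sqrtr// -(ler_pM2l C0) (le_trans (bx x))//.
  by rewrite (mulrA C (_ - _)) mulrBr divff// gt_eqF.
rewrite -(@ler_pXn2r _ 2) ?nnegrE ?rnorm_ge0 ?sqrtr_ge0// sqr_sqrtr//.
by rewrite -subr_ge0 addrAC subrr sub0r oppr_ge0 leNgt invr_gt0 C0.
Qed.

Lemma rep_contractive a : A a -> rnorm (s a) <= rnorm a.
Proof.
move=> Aa; have Aaa : A (adj a * a) by apply: csM => //; exact: csJ.
rewrite -(@ler_pXn2r _ 2) ?nnegrE ?rnorm_ge0// (le_trans (rnorm_cstar _))//.
rewrite -repJ// -repM//; last exact: csJ.
rewrite (le_trans (rep_contractive_sa _ _))//; first by rewrite adjM adjK.
by rewrite (le_trans (rnorm_opM _ _))// rnorm_adj.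
Qed.

(* The lift is [a (1 + a^* a)^-1]. *)
Lemma rep_half_lift a (r : R) : 0 < r -> A a -> rnorm (s a) <= r ->
  exists b, [/\ A b, rnorm b <= r / 2 & rnorm (s a - s b) <= r / 2].
Proof.
wlog -> : r a / r = 1.
  move=> wl r0 Aa ar.
  have Ara : A (r^-1%:C *: a) by exact: csZ.
  have [||b [Ab b1 ab]] := wl 1 (r^-1%:C *: a) erefl ltr01 => //.
    by rewrite repZ// rnormZr ?invr_ge0 ?(ltW r0)// ler_pdivrMl// mulr1.
  exists (r%:C *: b); split; first exact: csZ.
    by rewrite rnormZr ?(ltW r0)// -[leRHS]mul1r mulrCA ler_pM2l.
  have -> : s a - s (r%:C *: b) = r%:C *: (s (r^-1%:C *: a) - s b).
    rewrite scalerBr !repZ// scalerA -rmorphM/= divff ?gt_eqF//.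
    by rewrite scale1r.
  by rewrite rnormZr ?(ltW r0)// -[leRHS]mul1r mulrCA ler_pM2l.
move=> _ Aa a1; rewrite mul1r.
have Aaa : A (adj a * a) by apply: csM => //; exact: csJ.
have A1aa : A (1 + adj a * a) by exact: csD.
have [|d [Ad d1 d2]] := @cs_inverse _ _ _ csA A1 (1 + adj a * a) 1 ltr01 A1aa.
  move=> x; rewrite mul1r bopDE bop1E bopME rdotDl rdotxx rdot_adjl rdotxx.
  by rewrite lerDl sqr_ge0.
exists (a * d); split; [exact: csM|exact: rnorm_bounded_mul_inverse|].
have sd1 : (1 + adj (s a) * s a) * s d = 1.
  have <- : s (1 + adj a * a) = 1 + adj (s a) * s a.
    by rewrite repD// rep1 repM ?repJ//; exact: csJ.
  by rewrite -repM// d1 rep1.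
rewrite repM//.
(* With [b = s a] one has [1 - s d = b^* b (s d)], so the error is [b b^*], of norm at most 1, times
   [b (s d)], of norm at most [1/2]. *)
have -> : s a - s a * s d = s a * adj (s a) * (s a * s d).
  rewrite -{1}[s a]mulr1 -sd1 mulrDl mul1r mulrDr addrC addKr !mulrA.
  by [].
rewrite (le_trans (rnorm_opM _ _))// -[leRHS]mul1r ler_pM ?rnorm_ge0//.
  by rewrite (le_trans (rnorm_opM _ _))// rnorm_adj mulr_ile1 ?rnorm_ge0.
exact: rnorm_bounded_mul_inverse.
Qed.

(** The ratio [7/8] is [1/4 + 5/8]: a point [s c] within [r/4] of [T] satisfies
    [|s (c - a)| <= 5/4 r], and a half lift of [c - a] leaves half of that. *)
Lemma rep_lift_step T a (r : R) : 0 < r -> A a -> rnorm (T - s a) <= r ->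
  (forall e : R, 0 < e -> exists2 b, A b & rnorm (T - s b) < e) ->
  exists b, [/\ A b, rnorm (b - a) <= r & rnorm (T - s b) <= 7 / 8 * r].
Proof.
move=> r0 Aa ar Tcl; have [|c Ac Tc] := Tcl (r / 4); first by rewrite divr_gt0.
have r1 : 0 < 5 / 4 * r by rewrite mulr_gt0.
have [||b [Ab br cb]] := @rep_half_lift (c - a) _ r1.
- exact: csB.
- rewrite repB// (le_trans (ler_rdistD T _ _))// rdistC; lra.
exists (a + b); split; first exact: csD.
  rewrite addrC addKr; lra.
rewrite repD// (le_trans (ler_rdistD (s c) _ _))//.
move: cb; rewrite repB// opprD addrA; lra.
Qed.

(** Only norm closedness has content. As in the open mapping theorem, approximate preimages are
    corrected by geometrically decreasing amounts and converge in [A]. *)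
Lemma rep_image_cstar : cstar_subalgebra (s @` A).
Proof.
apply: cstar_subalgebra_intro.
- by exists 0; [exact: cs0|exact: rep0].
- move=> k _ _ [a Aa <-] [b Ab <-]; exists (k *: a + b); last exact: repP.
  exact: csP.
- move=> _ _ [a Aa <-] [b Ab <-]; exists (a * b); last exact: repM.
  exact: csM.
- by move=> _ [a Aa <-]; exists (adj a); [exact: csJ|exact: repJ].
move=> T Tcl'.
have Tcl e : 0 < e -> exists2 b, A b & rnorm (T - s b) < e.
  by move=> /Tcl'[_ [b Ab <-]]; exists b.
(* The summand 1 keeps [r n] positive when [T = 0]; the start [u 0 = 0] has error [rnorm T], below
   [r 0]. *)
pose r n : R := (rnorm T + 1) * (7 / 8) ^+ n.
have r0 n : 0 < r n by rewrite mulr_gt0 ?exprn_gt0// ltr_wpDl ?rnorm_ge0.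
(* The correction depends on the stage and on the current preimage, so the choice runs over pairs;
   where the bound fails, the value is arbitrary. *)
have /choice[f fP] : forall na : nat * 'B(H), exists b,
    A na.2 -> rnorm (T - s na.2) <= r na.1 ->
    [/\ A b, rnorm (b - na.2) <= r na.1 & rnorm (T - s b) <= 7 / 8 * r na.1].
  move=> [n a] /=; have [[Aa Ta]|h] := pselect (A a /\ rnorm (T - s a) <= r n).
    by have [b bP] := rep_lift_step (r0 n) Aa Ta Tcl; exists b.
  by exists a => Aa Ta; exfalso; apply: h.
pose u := fix u n : 'B(H) := if n is m.+1 then f (m, u m) else 0.
have uP n : A (u n) /\ rnorm (T - s (u n)) <= r n.
  elim: n => [|n [An Tn]]; first split; first exact: cs0.
    by rewrite rep0 subr0 /r expr0 mulr1 lerDl.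
  by have [Ab _] := fP (n, u n) An Tn; rewrite /r exprS mulrCA.
have uq n : rnorm (u n.+1 - u n) <= (rnorm T + 1) * (7 / 8) ^+ n.
  by have [] := fP (n, u n) (uP n).1 (uP n).2.
have [|a ua] := @bop_complete _ _ u.
  by apply: geometric_cauchy uq; apply/andP; split; lra.
have Aa : A a by apply: cs_rlim ua => // n; exact: (uP n).1.
exists a => //.
have sua : rlim (fun n => s (u n)) (s a).
  apply: (@rlim_lipschitz _ _ _ s 1) ua => n.
  have An := (uP n).1; rewrite mul1r -repB//.
  by apply: rep_contractive; exact: csB.
apply: rlim_unique sua _ => e e0.
have e1 : 0 < e / (rnorm T + 1) by rewrite divr_gt0// ltr_wpDl ?rnorm_ge0.
have q1 : `|7 / 8 : R| < 1 by rewrite ger0_norm; lra.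
have /cvgrPdist_lt /(_ _ e1)[N _ NP] := cvg_expr q1.
exists N => n Nn; rewrite (le_trans (uP n).2)//.
have := NP _ Nn; rewrite /= sub0r normrN ger0_norm ?exprn_ge0//.
by rewrite ltr_pdivlMr ?ltr_wpDl ?rnorm_ge0// mulrC => /ltW.
Qed.

End StarRepresentations.

(** * Completely positive maps *)

Lemma dot_selfadjoint (R : realType) (H : hilbertType R) (a : 'B(H)) x :
  adj a = a -> dot (a x) x = (rdot (a x) x)%:C.
Proof.
move=> aa; rewrite dotE; congr (_ +i* _).
have : rdot (a x) ('i *: x) = - rdot (a x) ('i *: x).
  by rewrite -rdotiC -bopZ -{1}aa rdot_adjl rdotC.
lra.
Qed.

Section CompletelyPositiveMaps.
Variables (R : realType) (H K : hilbertType R).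
Variables (A : set 'B(H)) (f : 'B(H) -> 'B(K)).
Hypotheses (csA : cstar_subalgebra A) (A1 : A 1) (uf : ucp A f).
Implicit Types (a b c : 'B(H)) (x y z : K).

Lemma ucpP k a b : A a -> A b -> f (k *: a + b) = k *: f a + f b.
Proof. by move=> /mem_set Aa /mem_set Ab; case: uf => h _ _; exact: h. Qed.

Lemma ucp1 : f 1 = 1.
Proof. by case: uf. Qed.

Lemma ucpB a b : A a -> A b -> f (a - b) = f a - f b.
Proof. by move=> Aa Ab; rewrite addrC -scaleN1r ucpP// scaleN1r addrC. Qed.

Lemma ucp0 : f 0 = 0.
Proof. by rewrite -(subrr 1) ucpB// subrr. Qed.

Lemma ucpZ k a : A a -> f (k *: a) = k *: f a.
Proof.
by move=> Aa; rewrite -[k *: a]addr0 ucpP ?ucp0 ?addr0//; exact: cs0.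
Qed.

(** The matrix of the products [adj (v i) * v j] is positive because its form at [y] is the squared
    norm of [\sum_i v i (y i)]. *)
Lemma ucp_gram n (v : 'I_n -> 'B(H)) (x : 'I_n -> K) : (forall i, A (v i)) ->
  0 <= \sum_i \sum_j dot (f (adj (v i) * v j) (x j)) (x i).
Proof.
move=> Av; case: uf => _ _ /(_ n (\matrix_(i, j) (adj (v i) * v j))) cp.
have -> : \sum_i \sum_j dot (f (adj (v i) * v j) (x j)) (x i) =
    \sum_i \sum_j dot (map_mx f (\matrix_(i, j) (adj (v i) * v j)) i j (x j)) (x i).
  by apply: eq_bigr => i _; apply: eq_bigr => j _; rewrite !mxE.
apply: cp => [i j|y]; first by rewrite mxE; apply: csM => //; exact: csJ.
have -> : \sum_i \sum_j dot ((\matrix_(i, j) (adj (v i) * v j)) i j (y j)) (y i) =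
    dot (\sum_i v i (y i)) (\sum_i v i (y i)).
  rewrite linear_sumr; apply: eq_bigr => i _.
  rewrite linear_sumlz; apply: eq_bigr => j _.
  by rewrite mxE bopME dot_adj adjK.
by rewrite dotxxE ler0c sqr_ge0.
Qed.

(** Nonnegativity in [R[i]] includes being real: the imaginary part of the Gram form of [1, b]
    vanishes, and ['i *: x] in the first slot turns it into the difference of the real parts to be
    compared. *)
Lemma ucp_adj b : A b -> f (adj b) = adj (f b).
Proof.
move=> Ab; apply/esym/adj_unique => y x.
have f11 z : complex.Im (dot (f (adj b * b) z) z) = 0.
  have := @ucp_gram 1 (fun=> b) (fun=> z) (fun=> Ab).
  by rewrite !big_ord_recl !big_ord0 !addr0 => /ger0_Im.
have Av (i : 'I_2) : A (nth 0 [:: 1; b] i) by case: i => -[|[|]].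
have := ucp_gram (fun i : 'I_2 => nth 0 [:: 'i *: x; y] i) Av.
rewrite !big_ord_recl !big_ord0 /= !addr0 adj1 !mul1r mulr1 ucp1 bop1E.
move=> /ger0_Im; rewrite !raddfD/= f11 addr0 dotxxE/= add0r.
rewrite !dotE/= bopZ rdotZi scalerA -expr2 sqr_i scaleN1r rdotNr addrC.
by move=> /eqP; rewrite subr_eq0 => /eqP <-; rewrite rdotC.
Qed.

(* The 3 x 3 Gram matrix of (1, b, c) is positive, and so is its image; it is
   evaluated at the vector (- (f b y + f c z), y, z). *)
Lemma ucp_schwarz2 b c y z : A b -> A c ->
  0 <= rdot (f (adj b * b) y) y - rnorm (f b y) ^+ 2 +
       (rdot (f (adj c * c) z) z - rnorm (f c z) ^+ 2) +
       2 * (rdot (f (adj b * c) z) y - rdot (f c z) (f b y)).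
Proof.
move=> Ab Ac; set x := - (f b y + f c z).
have Av (i : 'I_3) : A (nth 0 [:: 1; b; c] i) by case: i => -[|[|[|]]].
have := ucp_gram (fun i : 'I_3 => nth 0 [:: x; y; z] i) Av.
rewrite !big_ord_recl !big_ord0 /= !addr0 adj1 !mul1r !mulr1 ucp1 bop1E.
have -> : f (adj c * b) = adj (f (adj b * c)).
  by rewrite -ucp_adj ?adjM ?adjK//; apply: csM => //; exact: csJ.
move=> /Re_ge0; rewrite !Re_addc -!/(rdot _ _).
rewrite !ucp_adj// !rdot_adjl [rdot y (f (_ * _) z)]rdotC.
rewrite /x !rdotNl !rdotNr opprK !rdotDl !rdotDr !rdotxx.
rewrite (rdotC (f b y) (f c z)); lra.
Qed.

Lemma ucp_schwarz b y : A b -> rnorm (f b y) ^+ 2 <= rdot (f (adj b * b) y) y.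
Proof.
move=> Ab; have := ucp_schwarz2 y 0 Ab Ab.
rewrite !bop0 !(rdotC 0) !rdot0r rnorm0; lra.
Qed.

(** Choi's multiplicative domain: once the Schwarz defect of [b] vanishes, replacing [y] by [t y]
    leaves an affine function of the real [t] that stays nonnegative, so its slope is 0. *)
Lemma ucp_multiplicative b c : A b -> A c ->
  (forall y, rdot (f (adj b * b) y) y <= rnorm (f b y) ^+ 2) ->
  f (adj b * c) = adj (f b) * f c.
Proof.
move=> Ab Ac fb; apply: bopP => z; apply: rdot_inj => y.
rewrite bopME -rdot_adj ![rdot _ (f _ z)]rdotC.
set D := rdot (f (adj c * c) z) z - rnorm (f c z) ^+ 2.
have h0 w : 0 <= D + 2 * (rdot (f (adj b * c) z) w - rdot (f c z) (f b w)).
  by have := ucp_schwarz2 w z Ab Ac; have := fb w; rewrite /D; lra.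
have h t : 0 <= D + 2 * (t * (rdot (f (adj b * c) z) y - rdot (f c z) (f b y))).
  by have := h0 (t%:C *: y); rewrite bopZ !rdotZr -mulrBr.
apply/eqP; rewrite -subr_eq0; apply/eqP; move: h; set p := _ - _ => h.
have [//|p0] := eqVneq p 0.
have := h ((- D - 1) / (2 * p)); rewrite (_ : _ + _ = -1); last by field.
by rewrite ler0N1.
Qed.

Lemma ucp_pos a x : A a -> adj a = a -> (forall v : H, 0 <= rdot (a v) v) ->
  0 <= rdot (f a x) x.
Proof.
move=> Aa aa a0; case: uf => _ _ /(_ 1%N (const_mx a)) cp.
have Aij (i j : 'I_1) : A ((const_mx a : 'M['B(H)]_1) i j) by rewrite mxE.
have /(cp Aij)/(_ (fun=> x)) : positive_mx (const_mx a : 'M['B(H)]_1).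
  move=> v; rewrite !big_ord_recl !big_ord0 !addr0 mxE.
  by rewrite dot_selfadjoint// ler0c.
by rewrite !big_ord_recl !big_ord0 !addr0 !mxE => /Re_ge0.
Qed.

(** Schwarz reduces this to [f (a^* a) <= |a|^2], that is, to positivity of [f] on
    [|a|^2 - a^* a]. *)
Lemma ucp_contractive a : A a -> rnorm (f a) <= rnorm a.
Proof.
move=> Aa; apply: rnorm_op_le => [|x]; first exact: rnorm_ge0.
rewrite -(@ler_pXn2r _ 2) ?nnegrE ?mulr_ge0 ?rnorm_ge0//.
rewrite (le_trans (ucp_schwarz x Aa))// exprMn.
have Aaa : A (adj a * a) by apply: csM => //; exact: csJ.
pose k : 'B(H) := (rnorm a ^+ 2)%:C *: (1 : 'B(H)) - adj a * a.
have Ak : A k by apply: csB => //; exact: csZ.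
have kk : adj k = k by rewrite adjB adjZr adj1 adjM adjK.
have := ucp_pos x Ak kk; rewrite ucpB ?ucpZ ?ucp1//; last exact: csZ.
rewrite bopBE bopZE bop1E rdotBl rdotZl rdotxx subr_ge0; apply => y.
rewrite bopBE bopZE bop1E bopME rdotBl rdotZl rdotxx rdot_adjl rdotxx.
rewrite subr_ge0 -exprMn ler_pXn2r ?nnegrE ?mulr_ge0 ?rnorm_ge0//.
exact: rnorm_op_ub.
Qed.

End CompletelyPositiveMaps.

(** * Strong limits of unitary conjugates *)

Section StrongLimits.
Variables (R : realType) (K : hilbertType R) (I : Type) (F : set_system I).
Hypothesis FF : ProperFilter F.
Implicit Types (S T : I -> 'B(K)) (a b : 'B(K)).

Definition sot_cvg S a :=
  forall x (e : R), 0 < e -> \forall i \near F, rnorm (S i x - a x) < e.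

Lemma sot_cvg_cst a : sot_cvg (fun=> a) a.
Proof. by move=> x e e0; apply: nearW => i; rewrite subrr rnorm0. Qed.

Lemma sot_cvgP (k : R[i]) S T a b : sot_cvg S a -> sot_cvg T b ->
  sot_cvg (fun i => k *: S i + T i) (k *: a + b).
Proof.
move=> Sa Tb x e e0; have e2 : 0 < e / 2 by rewrite divr_gt0.
have k1 : 0 < rnorm (k : R[i]^o) + 1 by rewrite ltr_wpDl ?rnorm_ge0.
have e2k : 0 < e / 2 / (rnorm (k : R[i]^o) + 1) by rewrite divr_gt0.
apply: filterS2 (Sa x _ e2k) (Tb x _ e2) => i.
rewrite ltr_pdivlMr// !bopDE !bopZE opprD addrACA -scalerBr => hS hT.
rewrite (le_lt_trans (ler_rnormD _ _))// rnormZ.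
have := rnorm_ge0 (S i x - a x); lra.
Qed.

(** Splitting [S T x - a b x] as [S (T x - b x) + (S - a) (b x)] shows that only the left factor has
    to be bounded. *)
Lemma sot_cvgM (C : R) S T a b : (forall i, rnorm (S i) <= C) ->
  sot_cvg S a -> sot_cvg T b -> sot_cvg (fun i => S i * T i) (a * b).
Proof.
move=> SC Sa Tb x e e0; have e2 : 0 < e / 2 by rewrite divr_gt0.
have C1 : 0 < `|C| + 1 by rewrite ltr_wpDl.
have e2k : 0 < e / 2 / (`|C| + 1) by rewrite divr_gt0.
apply: filterS2 (Sa (b x) _ e2) (Tb x _ e2k) => i hS.
rewrite ltr_pdivlMr// !bopME => hT.
rewrite (le_lt_trans (ler_rdistD (S i (b x)) _ _))// -bopB.
rewrite (splitr e) ler_ltD// (le_trans (rnorm_op_ub _ _))//.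
rewrite (le_trans _ (ltW hT))// mulrC ler_wpM2l ?rnorm_ge0//.
by rewrite (le_trans (SC i))// (le_trans (ler_norm C))// lerDl.
Qed.

Lemma sot_cvg_le (C : R) S a : 0 <= C -> sot_cvg S a ->
  (forall i, rnorm (S i) <= C) -> rnorm a <= C.
Proof.
move=> C0 Sa SC; apply: rnorm_op_le => // x; apply/ler_addgt0Pr => e e0.
have /filter_ex[i Si] := Sa x _ e0.
rewrite -[a x](subrK (S i x)) addrC (le_trans (ler_rnormD _ _))// lerD//.
  by rewrite (le_trans (rnorm_op_ub _ _))// ler_wpM2r ?rnorm_ge0.
by rewrite rdistC ltW.
Qed.

Lemma sot_cvg_unique S a b : sot_cvg S a -> sot_cvg S b -> a = b.
Proof.
move=> Sa Sb; apply/eqP; rewrite -subr_eq0; apply/eqP/rnorm_eq0/le_anti.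
rewrite rnorm_ge0 andbT addrC -scaleN1r.
apply: (sot_cvg_le (lexx 0) (sot_cvgP (-1) Sb Sa)) => i.
by rewrite scaleN1r addNr rnorm0.
Qed.

End StrongLimits.

Section UnitaryConjugation.
Variables (R : realType) (K : hilbertType R).
Implicit Types (u a b : 'B(K)).

Definition uconj u a : 'B(K) := adj u * a * u.

Lemma unitary_rnorm u x : unitary u -> rnorm (u x) = rnorm x.
Proof.
move=> [uu _]; apply/eqP.
rewrite -(@eqrXn2 _ 2) ?rnorm_ge0// -!rdotxx rdot_adj -bopME uu.
by rewrite bop1E.
Qed.

Lemma unitary_adj u : unitary u -> unitary (adj u).
Proof. by move=> [u1 u2]; split; rewrite adjK. Qed.

Lemma rnorm_uconj u a : unitary u -> rnorm (uconj u a) <= rnorm a.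
Proof.
move=> uu; apply: rnorm_op_le => [|x]; first exact: rnorm_ge0.
rewrite !bopME unitary_rnorm; last exact: unitary_adj.
by rewrite (le_trans (rnorm_op_ub _ _))// unitary_rnorm.
Qed.

Lemma uconjP u k a b : uconj u (k *: a + b) = k *: uconj u a + uconj u b.
Proof. by rewrite /uconj mulrDr mulrDl bopZMr bopZMl. Qed.

Lemma uconjB u a b : uconj u (a - b) = uconj u a - uconj u b.
Proof. by rewrite /uconj mulrBr mulrBl. Qed.

Lemma uconjM u a b : unitary u -> uconj u (a * b) = uconj u a * uconj u b.
Proof.
move=> [_ u2]; rewrite /uconj !mulrA -(mulrA (adj u * a) u (adj u)) u2.
by rewrite mulr1.
Qed.

Lemma uconj1 u : unitary u -> uconj u 1 = 1.
Proof. by move=> [u1 _]; rewrite /uconj mulr1. Qed.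

End UnitaryConjugation.

Section StrongLimitAlgebra.
Variables (R : realType) (K : hilbertType R) (I : Type) (F : set_system I).
Variables (u : I -> 'B(K)) (C : set 'B(K)).
Hypotheses (FF : ProperFilter F) (uu : forall i, unitary (u i)).
Hypotheses (csC : cstar_subalgebra C) (C1 : C 1).
Implicit Types (a b : 'B(K)).

(** The adjoint is not strongly continuous, so its convergence is part of the relation. Being a
    relation, it is shown stable under the operations before any limit is chosen. *)
Definition limit_of b a :=
  [/\ C a, sot_cvg F (fun i => uconj (u i) b) a
    & sot_cvg F (fun i => uconj (u i) (adj b)) (adj a)].

Lemma limit_of1 : limit_of 1 1.
Proof.
have uE : (fun i => uconj (u i) 1) = fun=> 1.
  by apply/funext => i; rewrite uconj1.
by split; rewrite ?adj1 ?uE//; exact: sot_cvg_cst.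
Qed.

Lemma limit_ofP k b b' a a' : limit_of b a -> limit_of b' a' ->
  limit_of (k *: b + b') (k *: a + a').
Proof.
move=> [Ca ba ba'] [Ca' b'a' b'a'']; split; first exact: csP.
  under eq_fun do rewrite uconjP; exact: sot_cvgP.
by rewrite !adjP; under eq_fun do rewrite uconjP; exact: sot_cvgP.
Qed.

Lemma limit_ofM b b' a a' : limit_of b a -> limit_of b' a' ->
  limit_of (b * b') (a * a').
Proof.
move=> [Ca ba ba'] [Ca' b'a' b'a'']; split; first exact: csM.
  under eq_fun do rewrite uconjM//.
  by apply: (@sot_cvgM _ _ _ _ _ (rnorm b)) => // i; exact: rnorm_uconj.
rewrite !adjM; under eq_fun do rewrite uconjM//.
by apply: (@sot_cvgM _ _ _ _ _ (rnorm (adj b'))) => // i; exact: rnorm_uconj.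
Qed.

Lemma limit_ofJ b a : limit_of b a -> limit_of (adj b) (adj a).
Proof. by move=> [Ca ba ba']; split; rewrite ?adjK//; exact: csJ. Qed.

Lemma limit_of_unique b a a' : limit_of b a -> limit_of b a' -> a = a'.
Proof. by move=> [_ ba _] [_ ba' _]; exact: sot_cvg_unique ba ba'. Qed.

Lemma limit_of_le b a : limit_of b a -> rnorm a <= rnorm b.
Proof.
move=> [_ ba _]; apply: (sot_cvg_le FF (rnorm_ge0 _) ba) => i.
exact: rnorm_uconj.
Qed.

(** Conjugation by unitaries is contractive, so the approximation of [b0] by [b n] is uniform in [i]
    and an [e / 3] argument applies. *)
Lemma sot_uconj_closed (b : nat -> 'B(K)) (a : nat -> 'B(K)) b0 a0 :
  (forall n, sot_cvg F (fun i => uconj (u i) (b n)) (a n)) ->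
  rlim b b0 -> rlim a a0 -> sot_cvg F (fun i => uconj (u i) b0) a0.
Proof.
move=> ba bb0 aa0 x e e0.
have x1 : 0 < rnorm x + 1 by rewrite ltr_wpDl ?rnorm_ge0.
have e3 : 0 < e / 3 by rewrite divr_gt0.
have [N hN] := bb0 _ (divr_gt0 e3 x1); have [M hM] := aa0 _ (divr_gt0 e3 x1).
set n := maxn N M.
have small (c : 'B(K)) : rnorm c <= e / 3 / (rnorm x + 1) -> rnorm (c x) <= e / 3.
  rewrite ler_pdivlMr// => h; rewrite (le_trans (rnorm_op_ub _ _))//.
  by rewrite (le_trans _ h)// ler_wpM2l ?rnorm_ge0// lerDl.
apply: filterS (ba n x _ e3) => i h.
rewrite (le_lt_trans (ler_rdistD (uconj (u i) (b n) x) _ _))//.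
have h1 : rnorm (uconj (u i) b0 x - uconj (u i) (b n) x) <= e / 3.
  rewrite -bopBE -uconjB; apply: small; rewrite (le_trans (rnorm_uconj _ _))//.
  by rewrite hN ?leq_maxl.
have h2 : rnorm (a n x - a0 x) <= e / 3.
  by rewrite -bopBE; apply: small; rewrite rdistC hM ?leq_maxr.
have := ler_rdistD (a n x) (uconj (u i) (b n) x) (a0 x); lra.
Qed.

Lemma limit_of_cstar : cstar_subalgebra [set b | exists a, limit_of b a].
Proof.
apply: cstar_subalgebra_intro.
- exists 0; have := limit_ofP (-1) limit_of1 limit_of1.
  by rewrite scaleN1r addNr.
- by move=> k b b' [a ba] [a' ba']; exists (k *: a + a'); exact: limit_ofP.
- by move=> b b' [a ba] [a' ba']; exists (a * a'); exact: limit_ofM.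
- by move=> b [a ba]; exists (adj a); exact: limit_ofJ.
move=> b0 cl.
have /choice[b bP] : forall n : nat, exists b, (exists a, limit_of b a) /\
    rnorm (b0 - b) < n.+1%:R^-1.
  by move=> n; have [|b Db bb0] := cl n.+1%:R^-1; [rewrite invr_gt0|exists b].
have /choice[a aP] : forall n, exists a, limit_of (b n) a.
  by move=> n; exact: (bP n).1.
have bl : rlim b b0.
  move=> e /invS_lt[N NP]; exists N => n Nn.
  by rewrite ltW// (lt_trans (bP n).2)// NP.
(* [limit_of_le] applied to differences makes the limits Cauchy; closedness of [C] then puts [a0] in
   [C]. *)
have [a0 al] : exists a0, rlim a a0.
  apply: bop_complete => e e0; have [N NP] := bl _ (divr_gt0 e0 (ltr0Sn _ 1)).
  exists N => m n Nm Nn; have := limit_of_le (limit_ofP (-1) (aP n) (aP m)).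
  rewrite !scaleN1r ![- _ + _]addrC => /le_trans; apply.
  rewrite (le_trans (ler_rdistD b0 _ _))// (splitr e) lerD ?NP//.
  by rewrite rdistC NP.
exists a0; split.
- by apply: cs_rlim al => // n; have [] := aP n.
- by apply: sot_uconj_closed bl al => n; have [] := aP n.
have adjl (c : nat -> 'B(K)) c0 : rlim c c0 -> rlim (fun n => adj (c n)) (adj c0).
  apply: (@rlim_lipschitz _ 'B(K) 'B(K) (@adj R K) 1) => n.
  by rewrite mul1r -adjB rnorm_adj.
by apply: sot_uconj_closed (adjl _ _ bl) (adjl _ _ al) => n; have [] := aP n.
Qed.

(** The default 0 is taken only where no limit exists; elsewhere [slimE] determines the value. *)
Definition slim b := xget 0 [set a | limit_of b a].

Lemma slimP b : (exists a, limit_of b a) -> limit_of b (slim b).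
Proof.
by move=> ba; have : [set a | limit_of b a] (slim b) by exact: xgetPex.
Qed.

Lemma slimE b a : limit_of b a -> slim b = a.
Proof.
by move=> ba; apply: (@limit_of_unique b) => //; apply: slimP; exists a.
Qed.

End StrongLimitAlgebra.

(* The Schwarz inequality for [f] bounds [|u^* f t u x|^2] by
   [<u^* f (t^* t) u x, x>], which turns weak convergence into strong. *)
Lemma wot_uconj_sot (R : realType) (H K : hilbertType R) (A : set 'B(H))
    (s f : 'B(H) -> 'B(K)) (I : Type) (F : set_system I) (u : I -> 'B(K)) :
  ProperFilter F -> (forall i, unitary (u i)) ->
  cstar_subalgebra A -> A 1 -> star_representation A s -> ucp A f ->
  {in A, forall t, wot_cvg F (fun i => adj (u i) * f t * u i) (s t)} ->
  forall t, A t -> sot_cvg F (fun i => uconj (u i) (f t)) (s t).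
Proof.
move=> FF uu csA A1 rs uf wot t At x e e0.
have wotr v y z (d : R) : A v -> 0 < d ->
    \forall i \near F, `|rdot (uconj (u i) (f v) y) z - rdot (s v y) z| < d.
  move=> /mem_set Av d0; have dC : 0 < d%:C by rewrite ltcR.
  have /cvgrPdist_lt /(_ _ dC) := wot _ Av y z.
  apply: filterS => i h; rewrite distrC -ltcR; apply: le_lt_trans h.
  rewrite (le_trans _ (normc_ge_Re _))// lecR /rdot.
  rewrite -/(uconj _ _).
  by move: (dot (s v y) z) (dot (uconj _ _ y) z) => [? ?] [? ?].
have Att : A (adj t * t) by apply: csM => //; exact: csJ.
(* The expanded square is below [e^2/4], from [t^* t], plus twice [e^2/4], from the cross term:
   [3/4 e^2] in all. *)
have d0 : 0 < e ^+ 2 / 4 by rewrite divr_gt0 ?exprn_gt0.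
apply: filterS2 (wotr _ x x _ Att d0) (wotr _ x (s t x) _ At d0) => i.
have -> : rdot (s (adj t * t) x) x = rnorm (s t x) ^+ 2.
  by rewrite (repM rs)//; [rewrite (repJ rs)// bopME rdot_adjl rdotxx|exact: csJ].
rewrite rdotxx !ltr_norml => /andP[_ h1] /andP[h2 _].
rewrite -(@ltr_pXn2r _ 2) ?nnegrE ?rnorm_ge0 ?(ltW e0)// rnormB_sqr.
have h3 : rnorm (uconj (u i) (f t) x) ^+ 2 <=
    rdot (uconj (u i) (f (adj t * t)) x) x.
  rewrite /uconj !bopME rdot_adjl unitary_rnorm; last exact: unitary_adj.
  exact: (ucp_schwarz csA A1 uf).
have := exprn_gt0 2 e0; lra.
Qed.

(** * Generated C*-algebras and ideals *)

Lemma tails_proper I (le : I -> I -> Prop) : directed le -> ProperFilter (tails le).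
Proof.
move=> [[i0] lexx letr leD]; apply: filter_from_proper.
  apply: filter_from_filter; first by exists i0.
  move=> i j _ _; have [k ik jk] := leD i j.
  by exists k => // l kl; split; [exact: letr kl|exact: letr kl].
by move=> i _; exists i; exact: lexx.
Qed.

Section GeneratedCstar.
Variables (R : realType) (H : hilbertType R).
Implicit Types (M P : set 'B(H)).

Lemma cstar_cs M : cstar_subalgebra (cstar M).
Proof.
apply: cstar_subalgebra_intro => [P [csP _]|k a b Aa Ab P PM|a b Aa Ab P PM
  |a Aa P PM|a cl P PM].
- exact: cs0.
- by apply: (csP PM.1); [exact: Aa|exact: Ab].
- by apply: (csM PM.1); [exact: Aa|exact: Ab].
- by apply: (csJ PM.1); exact: Aa.
- apply: (cs_closed PM.1) => e /cl[b Ab ab].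
  by exists b => //; exact: Ab.
Qed.

End GeneratedCstar.

Section ClosedIdeals.
Variables (R : realType) (H : hilbertType R) (B J : set 'B(H)).

Lemma closed_ideal_intro : J `<=` B -> J 0 ->
  (forall k a b, J a -> J b -> J (k *: a + b)) ->
  (forall b x, B b -> J x -> J (b * x) /\ J (x * b)) ->
  (forall a, (forall e : R, 0 < e -> exists2 b, J b & rnorm (a - b) < e) -> J a) ->
  closed_ideal B J.
Proof.
move=> JB J0 JP JM Jcl; split => //.
- split; first exact: mem_set.
  by move=> k a b /set_mem Ja /set_mem Jb; apply/mem_set/JP.
- by move=> b x /set_mem Bb /set_mem Jx; exact: JM.
- by apply/rnorm_closedP.
Qed.

Hypothesis iJ : closed_ideal B J.

Lemma ideal0 : J 0.
Proof. by case: iJ => _ [/set_mem]. Qed.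

Lemma idealP k a b : J a -> J b -> J (k *: a + b).
Proof.
by move=> /mem_set Ja /mem_set Jb; case: iJ => _ [_ h] _ _; apply/set_mem/h.
Qed.

Lemma idealD a b : J a -> J b -> J (a + b).
Proof. by move=> Ja Jb; rewrite -[a]scale1r; exact: idealP. Qed.

Lemma idealMl b x : B b -> J x -> J (b * x).
Proof. by move=> /mem_set Bb /mem_set Jx; case: iJ => _ _ /(_ b x Bb Jx)[]. Qed.

Lemma idealMr b x : B b -> J x -> J (x * b).
Proof. by move=> /mem_set Bb /mem_set Jx; case: iJ => _ _ /(_ b x Bb Jx)[]. Qed.

Lemma ideal_closed a :
  (forall e : R, 0 < e -> exists2 b, J b & rnorm (a - b) < e) -> J a.
Proof. by move: a; apply/rnorm_closedP; case: iJ. Qed.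

End ClosedIdeals.

(** * Maps determined by their values on generators *)

Section MoreRepresentations.
Variables (R : realType) (H K : hilbertType R).
Implicit Types (A M : set 'B(H)) (s : 'B(H) -> 'B(K)).

Lemma star_representation_intro A s :
  (forall k a b, A a -> A b -> s (k *: a + b) = k *: s a + s b) ->
  (forall a b, A a -> A b -> s (a * b) = s a * s b) ->
  (forall a, A a -> s (adj a) = adj (s a)) -> s 1 = 1 -> star_representation A s.
Proof.
move=> sP sM sJ s1; split => //.
- by move=> k a b /set_mem Aa /set_mem Ab; exact: sP.
- by move=> a b /set_mem Aa /set_mem Ab; exact: sM.
- by move=> a /set_mem Aa; exact: sJ.
Qed.

(** Reduces the inclusion of [s a] in [D], for [a] in a generated algebra, to the generators;
    contractivity of [s] gives closedness. *)
Lemma rep_preimage_cstar A s (D : set 'B(K)) : cstar_subalgebra A -> A 1 ->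
  star_representation A s -> cstar_subalgebra D ->
  cstar_subalgebra [set a | A a /\ D (s a)].
Proof.
move=> csA A1 rs csD; apply: cstar_subalgebra_intro.
- by split; [exact: cs0|rewrite (rep0 A1 rs); exact: cs0].
- move=> k a b [Aa Da] [Ab Db]; split; first exact: csP.
  by rewrite (repP rs)//; exact: csP.
- move=> a b [Aa Da] [Ab Db]; split; first exact: csM.
  by rewrite (repM rs)//; exact: csM.
- move=> a [Aa Da]; split; first exact: csJ.
  by rewrite (repJ rs)//; exact: csJ.
move=> a cl; have Aa : A a by apply: (cs_closed csA) => e /cl[b [Ab _] ab]; exists b.
split => //; apply: (cs_closed csD) => e /cl[b [Ab Db] ab]; exists (s b) => //.
rewrite -(repB rs)//; apply: le_lt_trans ab.
by apply: (rep_contractive csA A1 rs); exact: csB.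
Qed.

Lemma rep_ext M s1 s2 : cstar M 1 ->
  star_representation (cstar M) s1 -> star_representation (cstar M) s2 ->
  (forall a, M a -> s1 a = s2 a) -> forall a, cstar M a -> s1 a = s2 a.
Proof.
move=> A1 r1 r2 s12 a Aa; have csA := cstar_cs M.
suff : cstar M `<=` [set a | cstar M a /\ s1 a = s2 a] by move=> /(_ a Aa)[].
apply: smallest_sub; last by move=> b Mb; split; [exact: sub_gen_smallest|exact: s12].
apply: cstar_subalgebra_intro.
- by split; [exact: (cs0 csA)|rewrite (rep0 A1 r1) (rep0 A1 r2)].
- move=> k b c [Ab Eb] [Ac Ec]; split; first exact: (csP csA).
  by rewrite (repP r1)// (repP r2)// Eb Ec.
- move=> b c [Ab Eb] [Ac Ec]; split; first exact: (csM csA).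
  by rewrite (repM r1)// (repM r2)// Eb Ec.
- move=> b [Ab Eb]; split; first exact: (csJ csA).
  by rewrite (repJ r1)// (repJ r2)// Eb.
move=> b cl; have Ab : cstar M b.
  by apply: (cs_closed csA) => e /cl[c [Ac _] bc]; exists c.
split => //; apply/eqP; rewrite -subr_eq0; apply/eqP/rnorm_eq0/le_anti.
rewrite rnorm_ge0 andbT; apply/ler_addgt0Pr => e e0; rewrite add0r.
have [|c [Ac Ec] bc] := cl (e / 2); first by rewrite divr_gt0.
rewrite (le_trans (ler_rdistD (s1 c) _ _))// {2}Ec -(repB r1)// -(repB r2)//.
rewrite (splitr e) lerD//.
  rewrite (le_trans _ (ltW bc))//.
  by apply: (rep_contractive csA A1 r1); exact: (csB csA).
rewrite (le_trans _ (ltW bc))// rdistC.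
by apply: (rep_contractive csA A1 r2); exact: (csB csA).
Qed.

(* Equality in the Schwarz inequality puts [M] in the multiplicative domain. *)
Lemma ucp_rep_ext M s (f : 'B(H) -> 'B(K)) : cstar M 1 ->
  star_representation (cstar M) s -> ucp (cstar M) f ->
  (forall a, M a -> M (adj a)) -> (forall a, M a -> f a = s a) ->
  (forall a y, M a -> rdot (f (adj a * a) y) y <= rnorm (f a y) ^+ 2) ->
  forall a, cstar M a -> f a = s a.
Proof.
move=> A1 rs uf MJ fs fM; have csA := cstar_cs M.
pose mult b := forall c, cstar M c -> f (b * c) = f b * f c.
have fJ b : cstar M b -> f (adj b) = adj (f b).
  by move=> Ab; exact: (ucp_adj csA A1 uf).
have multM b : M b -> mult b.
  (* [M] is stable under [adj], so the Schwarz equality is available at [adj b], whose adjoint is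
     [b]. *)
  move=> Mb c Ac; rewrite -[b]adjK (@ucp_multiplicative _ _ _ _ _ csA A1 uf)//.
  - by rewrite -fJ//; apply: sub_gen_smallest; exact: MJ.
  - by apply: sub_gen_smallest; exact: MJ.
  - by move=> y; apply: fM; exact: MJ.
have mult_closed b : cstar M b ->
    (forall e : R, 0 < e -> exists c, [/\ cstar M c, mult c & rnorm (b - c) < e]) ->
    mult b.
  move=> Ab cl c Ac; apply/eqP; rewrite -subr_eq0; apply/eqP/rnorm_eq0/le_anti.
  rewrite rnorm_ge0 andbT; apply/ler_addgt0Pr => e e0; rewrite add0r.
  have c1 : 0 < rnorm c + 1 by rewrite ltr_wpDl ?rnorm_ge0.
  have [|d [Ad md]] := cl (e / 2 / (rnorm c + 1)); first by rewrite !divr_gt0.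
  rewrite ltr_pdivlMr// => bd.
  rewrite (le_trans (ler_rdistD (f (d * c)) _ _))// {2}md// -mulrBl.
  rewrite -!(ucpB uf)//; [|exact: (csM csA)|exact: (csM csA)].
  rewrite -mulrBl (splitr e) lerD//.
    rewrite (le_trans (ucp_contractive csA A1 uf _))//.
      by apply: (csM csA) => //; exact: (csB csA).
    rewrite (le_trans (rnorm_opM _ _))// (le_trans _ (ltW bd))//.
    by rewrite ler_wpM2l ?rnorm_ge0// lerDl.
  rewrite (le_trans (rnorm_opM _ _))// (le_trans _ (ltW bd))//.
  rewrite rdistC ler_pM ?rnorm_ge0//.
    by apply: (ucp_contractive csA A1 uf); exact: (csB csA).
  by rewrite (le_trans (ucp_contractive csA A1 uf Ac))// lerDl.
(* Taking adjoints moves the multiplicativity of [mult] to the other side, so [P] asks for it at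
   both [b] and [adj b]. *)
pose P : set 'B(H) := [set b | [/\ cstar M b, mult b, mult (adj b) & f b = s b]].
suff : cstar M `<=` P by move=> MP a /MP[].
have mult0 : mult 0 by move=> c Ac; rewrite mul0r (ucp0 A1 uf) mul0r.
have multP k b c : cstar M b -> cstar M c -> mult b -> mult c -> mult (k *: b + c).
  move=> Ab Ac mb mc d Ad; rewrite mulrDl bopZMl !(ucpP uf)//; try exact: (csM csA).
  by rewrite mb// mc// mulrDl bopZMl.
have multMM b c : cstar M b -> cstar M c -> mult b -> mult c -> mult (b * c).
  move=> Ab Ac mb mc d Ad; rewrite -mulrA mb; last exact: (csM csA).
  by rewrite mc// mulrA mb.
apply: smallest_sub; last first.
  move=> b Mb; split; [exact: sub_gen_smallest|exact: multM| |exact: fs].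
  exact/multM/MJ.
apply: cstar_subalgebra_intro.
- split; [exact: (cs0 csA)|by []| |by rewrite (ucp0 A1 uf) (rep0 A1 rs)].
  by have -> : adj (0 : 'B(H)) = 0 by rewrite -(subrr (1 : 'B(H))) adjB adj1.
- move=> k b c [Ab mb mb' Eb] [Ac mc mc' Ec].
  split; [exact: (csP csA)|exact: multP| |by rewrite (ucpP uf)// (repP rs)// Eb Ec].
  by rewrite adjP; apply: multP => //; exact: (csJ csA).
- move=> b c [Ab mb mb' Eb] [Ac mc mc' Ec].
  split; [exact: (csM csA)|exact: multMM| |by rewrite mb// (repM rs)// Eb Ec].
  by rewrite adjM; apply: multMM => //; exact: (csJ csA).
- move=> b [Ab mb mb' Eb]; split; [exact: (csJ csA)|by []|by rewrite adjK|].
  by rewrite fJ// (repJ rs)// Eb.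
move=> b cl; have Ab : cstar M b.
  by apply: (cs_closed csA) => e /cl[c [Ac _] _ bc]; exists c.
split => //.
- by apply: mult_closed => // e /cl[c [Ac mc _ _] bc]; exists c.
- apply: mult_closed => [|e /cl[c [Ac _ mc _] bc]]; first exact: (csJ csA).
  by exists (adj c); split; [exact: (csJ csA)|by []|rewrite -adjB rnorm_adj].
apply/eqP; rewrite -subr_eq0; apply/eqP/rnorm_eq0/le_anti.
rewrite rnorm_ge0 andbT; apply/ler_addgt0Pr => e e0; rewrite add0r.
have [|c [Ac _ _ Ec] bc] := cl (e / 2); first by rewrite divr_gt0.
rewrite (le_trans (ler_rdistD (f c) _ _))// {2}Ec -(ucpB uf)// -(repB rs)//.
rewrite (splitr e) lerD//.
  rewrite (le_trans _ (ltW bc))//.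
  by apply: (ucp_contractive csA A1 uf); exact: (csB csA).
rewrite (le_trans _ (ltW bc))// rdistC.
by apply: (rep_contractive csA A1 rs); exact: (csB csA).
Qed.

End MoreRepresentations.

(** * The expectation [Gamma]: construction, unique extension, kernel *)

Theorem theorem1p3 (R : realType) (H Hpi : hilbertType R)
    (M : set 'B(H)) (pi psi : 'B(H) -> 'B(Hpi))
    (M_space : unital_operator_space M)
    (pi_rep : star_representation (cstar M) pi)
    (pi_auep : approximate_unique_extension_property M pi)
    (psi_ucp : ucp (cstar M) psi)
    (psi_pi : {in M, psi =1 pi}) :
  let Im_pi := pi @` cstar M in
  let Im_psi := psi @` cstar M in
  exists Gamma : 'B(Hpi) -> 'B(Hpi),
    (* (i) *)
    [/\ conditional_expectation (cstar Im_psi) Im_pi Gamma,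
        multiplicative_on (cstar Im_psi) Gamma
      & {in cstar M, Gamma \o psi =1 pi}] /\
    (* (ii) *)
    (star_representation (cstar Im_psi) Gamma /\
     unique_extension_property Im_psi Gamma) /\
    (* (iii) *)
    (kernel_on (cstar Im_psi) Gamma =
       smallest (closed_ideal (cstar Im_psi))
         [set psi t - pi t | t in cstar M] /\
     ({in cstar M, psi =1 pi} <-> isometric_on (cstar Im_psi) Gamma)).
Proof.
move=> Im_pi Im_psi; set A := cstar M; set B := cstar Im_psi.
have csA : cstar_subalgebra A by exact: cstar_cs.
have csB' : cstar_subalgebra B by exact: cstar_cs.
have A1 : A 1 by apply: sub_gen_smallest; exact: M_space.2.
have piM m : M m -> psi m = pi m by move=> /mem_set; exact: psi_pi.
have [I [le [u [dir uu wot]]]] := pi_auep psi psi_ucp psi_pi.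
have FF := tails_proper dir.
have csC : cstar_subalgebra Im_pi by exact: rep_image_cstar.
have C1 : Im_pi 1 by exists 1 => //; exact: rep1 pi_rep.
have psiJ t : A t -> psi (adj t) = adj (psi t).
  by move=> At; exact: (ucp_adj csA A1 psi_ucp).
have Bpsi t : A t -> B (psi t) by move=> At; apply: sub_gen_smallest; exists t.
have B1 : B 1 by rewrite -(ucp1 psi_ucp); exact: Bpsi.
have psi_sot := wot_uconj_sot FF uu csA A1 pi_rep psi_ucp wot.
have psi_lim t : A t -> limit_of (tails le) u Im_pi (psi t) (pi t).
  move=> At; split; [by exists t|exact: psi_sot|].
  rewrite -psiJ// -(repJ pi_rep)//; apply: psi_sot; exact: (csJ csA).
pose G := slim (tails le) u Im_pi.
have Glim b : B b -> limit_of (tails le) u Im_pi b (G b).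
  move=> Bb; apply: slimP.
  suff : B `<=` [set b | exists a, limit_of (tails le) u Im_pi b a] by exact.
  apply: smallest_sub; first exact: limit_of_cstar.
  by move=> _ [t At <-]; exists (pi t); exact: psi_lim.
have GE b a : limit_of (tails le) u Im_pi b a -> G b = a by exact: slimE.
have Gpsi t : A t -> G (psi t) = pi t by move=> /psi_lim/GE.
have rG : star_representation B G.
  apply: star_representation_intro.
  - by move=> k a b /Glim la /Glim lb; apply: GE; exact: limit_ofP.
  - by move=> a b /Glim la /Glim lb; apply: GE; exact: limit_ofM.
  - by move=> a /Glim la; apply: GE; exact: limit_ofJ.
  - by apply: GE; exact: limit_of1.
(* On [M] the maps [pi] and [psi] agree, so [pi] sends generators into [B]; as a representation it
   then sends all of [A] there. *)
have Bpi t : A t -> B (pi t).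
  move=> At; suff : A `<=` [set t | A t /\ B (pi t)] by move=> /(_ t At)[].
  apply: smallest_sub; first exact: rep_preimage_cstar.
  move=> m Mm; have Am : A m by exact: sub_gen_smallest.
  by split => //; rewrite -piM//; exact: Bpsi.
(* [G \o pi] and [pi] are representations of [A] that agree on [M], where [pi] is [psi]. This makes
   [G] a projection onto [Im_pi]. *)
have Gpi t : A t -> G (pi t) = pi t.
  apply: (@rep_ext _ _ _ M (G \o pi) pi) => //.
    apply: star_representation_intro => [k a b Aa Ab|a b Aa Ab|a Aa|] /=.
    - by rewrite (repP pi_rep)// (repP rG)//; exact: Bpi.
    - by rewrite (repM pi_rep)// (repM rG)//; exact: Bpi.
    - by rewrite (repJ pi_rep)// (repJ rG)//; exact: Bpi.
    - by rewrite (rep1 pi_rep) (rep1 rG).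
  move=> m Mm; have Am : A m by exact: sub_gen_smallest.
  by rewrite /= -piM// Gpsi// piM.
have GB b : B b -> Im_pi (G b) by move=> /Glim[].
have Im_piB : Im_pi `<=` B by move=> _ [t At <-]; exact: Bpi.
have GG b : B b -> G (G b) = G b.
  by move=> /GB[t At <-]; rewrite Gpi.
have Gle b : B b -> rnorm (G b) <= rnorm b by move=> /Glim; exact: limit_of_le.
have BG b : B b -> B (G b) by move=> /GB/Im_piB.
exists G; split; [|split; [split; [exact: rG|]|split]].
- split.
  + split; first by split.
    split.
    * by move=> k a b /set_mem Ba /set_mem Bb; exact: (repP rG).
    * by move=> b /set_mem Bb; rewrite -!rnormE lecR; exact: Gle.
    * apply/seteqP; split=> [_ [b Bb <-]|_ [t At <-]]; first exact: GB.
      by exists (pi t); [exact: Bpi|exact: Gpi].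
    * by move=> b /set_mem; exact: GG.
  + by move=> a b /set_mem Ba /set_mem Bb; exact: (repM rG).
  + by move=> t /set_mem; exact: Gpsi.
- move=> f uf fG b /set_mem.
  have fG' a : Im_psi a -> f a = G a by move=> /mem_set; exact: fG.
  apply: ucp_rep_ext => //.
    by move=> _ [t At <-]; exists (adj t); [exact: (csJ csA)|exact: psiJ].
  move=> _ y [t At <-].
  have Att : A (adj t * t) by apply: (csM csA) => //; exact: (csJ csA).
  have Bpp : B (adj (psi t) * psi t).
    by apply: (csM csB'); [apply: (csJ csB')|]; exact: Bpsi.
  (* [f (psi t^* psi t) <= f (psi (t^* t)) = pi (t^* t) = f (psi t)^* f (psi t)] *)
  have : 0 <= rdot (f (psi (adj t * t) - adj (psi t) * psi t) y) y.
    apply: (ucp_pos uf).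
    - by apply: (csB csB') => //; exact: Bpsi.
    - by rewrite adjB !adjM !adjK -psiJ// adjM adjK.
    - move=> v; rewrite bopBE bopME rdotBl rdot_adjl rdotxx subr_ge0.
      exact: (ucp_schwarz csA A1 psi_ucp).
  rewrite (ucpB uf)//; last exact: Bpsi.
  rewrite bopBE rdotBl subr_ge0 => /le_trans; apply.
  rewrite !fG'; [|by exists t|by exists (adj t * t)].
  rewrite !Gpsi// (repM pi_rep)//; last exact: (csJ csA).
  by rewrite (repJ pi_rep)// bopME rdot_adjl rdotxx.
- apply/seteqP; split=> [b [Bb Gb0] J [iJ SJ]|].
    (* [closed_ideal] says nothing about adjoints, so the clause on [adj b] is carried along to make
       this set stable under [adj]. *)
    suff BJ : B `<=` [set b | [/\ B b, J (b - G b) & J (adj b - G (adj b))]].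
      by have [_ + _] := BJ b Bb; rewrite Gb0 subr0.
    apply: smallest_sub; last first.
      move=> _ [t At <-]; split; first exact: Bpsi.
        by rewrite Gpsi//; apply: SJ; exists t.
      rewrite -psiJ// Gpsi; last exact: (csJ csA).
      by apply: SJ; exists (adj t) => //; exact: (csJ csA).
    have JP k a c : B a -> B c -> J (a - G a) -> J (c - G c) ->
        J (k *: a + c - G (k *: a + c)).
      move=> Ba Bc Ja Jc; rewrite (repP rG)// opprD addrACA -scalerBr.
      exact: (idealP iJ).
    have JM a c : B a -> B c -> J (a - G a) -> J (c - G c) ->
        J (a * c - G (a * c)).
      move=> Ba Bc Ja Jc; rewrite (repM rG)//.
      (* Each summand has one factor in [J] and one in [B]; this uses that [G] takes values in
         [B]. *)
      have -> : a * c - G a * G c = (a - G a) * c + G a * (c - G c).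
        by rewrite mulrBl mulrBr addrA subrK.
      by apply: (idealD iJ); [exact: (idealMr iJ)|apply: (idealMl iJ); first exact: BG].
    have Jcl a : B a -> (forall e : R, 0 < e ->
        exists c, [/\ B c, J (c - G c) & rnorm (a - c) < e]) -> J (a - G a).
      move=> Ba cl; apply: (ideal_closed iJ) => e e0.
      have [|c [Bc Jc ac]] := cl (e / 2); first by rewrite divr_gt0.
      (* Since [G] is contractive, passing from [a] to [a - G a] at most doubles distances, whence
         the [e / 2]. *)
      exists (c - G c) => //.
      rewrite opprB [G c - c]addrC addrACA [- G a + G c]addrC -(repB rG)//.
      have := ler_rnormD (a - c) (G (c - a)).
      have := Gle _ ((csB csB') _ _ Bc Ba); rewrite (rdistC c a); lra.
    apply: cstar_subalgebra_intro.
    + have J0 : J (0 - G 0) by rewrite (rep0 B1 rG) subrr; exact: (ideal0 iJ).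
      split; [exact: (cs0 csB')|by []|].
      by have -> : adj (0 : 'B(Hpi)) = 0 by rewrite -(subrr (1 : 'B(Hpi))) adjB adj1.
    + move=> k a c [Ba Ja Ja'] [Bc Jc Jc']; split; [exact: (csP csB')|exact: JP|].
      by rewrite adjP; apply: JP => //; exact: (csJ csB').
    + move=> a c [Ba Ja Ja'] [Bc Jc Jc']; split; [exact: (csM csB')|exact: JM|].
      by rewrite adjM; apply: JM => //; exact: (csJ csB').
    + by move=> a [Ba Ja Ja']; split; [exact: (csJ csB')|by []|rewrite adjK].
    + move=> a cl; have Ba : B a.
        by apply: (cs_closed csB') => e /cl[c [Bc _ _] ac]; exists c.
      split => //.
        by apply: Jcl => // e /cl[c [Bc Jc _] ac]; exists c.
      apply: Jcl => [|e /cl[c [Bc _ Jc] ac]]; first exact: (csJ csB').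
      by exists (adj c); split; [exact: (csJ csB')|by []|rewrite -adjB rnorm_adj].
  (* Conversely, the kernel is itself a closed ideal, and [G] takes the value [pi t] at both [psi t]
     and [pi t]. *)
  apply: smallest_sub; last first.
    move=> _ [t At <-]; split.
      by apply: (csB csB'); [exact: Bpsi|exact: Bpi].
    rewrite (repB rG) ?Gpsi ?Gpi ?subrr//; [exact: Bpsi|exact: Bpi].
  apply: closed_ideal_intro.
  + by move=> b [].
  + by split; [exact: (cs0 csB')|exact: (rep0 B1 rG)].
  + move=> k a b [Ba Ga] [Bb Gb]; split; first exact: (csP csB').
    by rewrite (repP rG)// Ga Gb scaler0 addr0.
  + move=> b x Bb [Bx Gx]; split; (split; first exact: (csM csB')).
      by rewrite (repM rG)// Gx mulr0.
    by rewrite (repM rG)// Gx mul0r.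
  + move=> a cl; have Ba : B a.
      by apply: (cs_closed csB') => e /cl[c [Bc _] ac]; exists c.
    split => //; apply/rnorm_eq0/le_anti; rewrite rnorm_ge0 andbT.
    apply/ler_addgt0Pr => e /cl[c [Bc Gc] ac]; rewrite add0r.
    rewrite -[G a]subr0 -Gc -(repB rG)// (le_trans (Gle _ _))//.
      exact: (csB csB').
    exact: ltW.
(* If [psi = pi], then [B] lies in [Im_pi], which [G] fixes pointwise; conversely, an isometric [G]
   is injective and kills every [psi t - pi t]. *)
- split=> [psi_eq b /set_mem Bb|Giso t /set_mem At].
    suff : B `<=` Im_pi by move=> /(_ b Bb)[t At <-]; rewrite Gpi.
    apply: smallest_sub => // _ [t At <-]; exists t => //.
    by rewrite psi_eq//; exact: mem_set.
  have Bd : B (psi t - pi t) by apply: (csB csB'); [exact: Bpsi|exact: Bpi].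
  apply/eqP; rewrite -subr_eq0 -normr_eq0 -Giso; last exact: mem_set.
  rewrite (repB rG) ?Gpsi ?Gpi ?subrr ?normr0//; [exact: Bpsi|exact: Bpi].
Qed.
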